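(* Let $0\le k\le m$ and let $M$ be a connected oriented Lagrangian submanifold of $C_k^m$ (with respect to $\omega_{(k,m)}$). Then $M$ is minimal (that is, its mean curvature vector $H$ vanishes identically) if and only if $dz(TM)$ is a constant complex number of norm $1$ on $M$, or equivalently, $dz_\theta(TM)\equiv 1$ on $M$ for some constant $\theta\in\mathbb{R}$.
   Context: $C_k^m$ denotes $\mathbb{C}^m=\mathbb{R}^{2m}$ with coordinates $z_j=x_j+iy_j$, standard complex structure $J$, the pseudo-Euclidean metric $g_{(2k,2m)}=\langle\cdot,\cdot\rangle=\sum_{j=1}^m\varepsilon_j(dx_j^2+dy_j^2)$ and the symplectic form $\omega_{(k,m)}=\sum_{j=1}^m\varepsilon_j\,dx_j\wedge dy_j$, where $\varepsilon_j=-1$ for $j\le k$ and $\varepsilon_j=1$ for $j\ge k+1$. A real $m$-dimensional submanifold $M\subset C_k^m$ is Lagrangian if $\omega_{(k,m)}|_M\equiv0$ and the metric induced on $M$ by $g_{(2k,2m)}$ is non-degenerate; the induced metric then has index $k$ ($k$ negative directions). A Lorentz basis of $T_pM$ is a basis $e_1,\dots,e_m$ with $\langle e_j,e_l\rangle=\varepsilon_j\delta_{jl}$. The second fundamental form is $h(X,Y)=(D_XY)^{\perp}$, where $D$ is the flat connection and $\perp$ is the $g_{(2k,2m)}$-orthogonal projection to the normal space; the mean curvature vector is $H=\sum_{j=1}^m\varepsilon_j h(e_j,e_j)$ for a Lorentz basis. $dz=dz_1\wedge\cdots\wedge dz_m$ and $dz_\theta=e^{i\theta}dz$. $dz(TM)$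 denotes the function on $M$ whose value at $p$ is $dz(e_1,\dots,e_m)$ for any positively oriented Lorentz basis of $T_pM$ (independent of the choice); similarly for $dz_\theta(TM)$. *)

(* Defs.v *)
From mathcomp Require Import all_boot all_order all_algebra.
From mathcomp Require Import all_classical reals topology normedtype derive trigo.
From mathcomp Require Import complex.

Set Implicit Arguments.
Unset Strict Implicit.
Unset Printing Implicit Defensive.

Import Order.TTheory GRing.Theory Num.Theory.
Import numFieldNormedType.Exports.

Local Open Scope classical_set_scope.
Local Open Scope ring_scope.

(* The real vector space C^m = R^{2m}: a vector v is the pair (x, y) with
   z_j = x_j + i y_j. *)
Notation Cspace R m := ('rV[R]_m * 'rV[R]_m)%type.

Section PseudoHermitianSpace.
Variables (R : realType) (m k : nat).
Implicit Types v w : Cspace R m.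

(* Indices are 0-based: the first k signs are -1. *)
Definition eps (j : 'I_m) : R := if (j < k)%N then -1 else 1.

Definition metric v w : R :=
  \sum_(j < m) eps j * (v.1 ord0 j * w.1 ord0 j + v.2 ord0 j * w.2 ord0 j).

Definition omega v w : R :=
  \sum_(j < m) eps j * (v.1 ord0 j * w.2 ord0 j - v.2 ord0 j * w.1 ord0 j).

Definition zcoord v (j : 'I_m) : R[i] := Complex (v.1 ord0 j) (v.2 ord0 j).

(* dz = dz_1 /\ ... /\ dz_m, with the normalization
   (a_1 /\ ... /\ a_m)(e_1, ..., e_m) = det (a_j(e_l)). *)
Definition dz (e : 'I_m -> Cspace R m) : R[i] :=
  \det (\matrix_(j < m, l < m) zcoord (e l) j).

Definition expi (theta : R) : R[i] := Complex (cos theta) (sin theta).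

Definition dz_theta (theta : R) (e : 'I_m -> Cspace R m) : R[i] :=
  expi theta * dz e.

End PseudoHermitianSpace.

Fixpoint Cr_on (R : realType) (V W : normedModType R) (r : nat)
    (U : set V) (f : V -> W) : Prop :=
  match r with
  | 0 => forall u, U u -> {for u, continuous f}
  | r'.+1 => (forall u, U u -> differentiable f u) /\
             (forall v, Cr_on r' U (fun u => 'd f u v))
  end.

(* C^oo on U, where U is meant to be open. *)
Definition smooth_on (R : realType) (V W : normedModType R)
    (U : set V) (f : V -> W) : Prop := forall r, Cr_on r U f.

(* Charts are given by total functions, of which only the restrictions
   ccoord : cdom -> cimg and cparam : cimg -> cdom are meaningful. *)
Record chart (R : realType) (T : topologicalType) (m : nat) := Chart {
  cdom : set T ;
  cimg : set 'rV[R]_m ;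
  ccoord : T -> 'rV[R]_m ;
  cparam : 'rV[R]_m -> T }.

Definition is_chart (R : realType) (T : topologicalType) m (c : chart R T m) :=
  [/\ open (cdom c) /\ open (cimg c),
      (forall p, cdom c p -> cimg c (ccoord c p) /\ cparam c (ccoord c p) = p),
      (forall u, cimg c u -> cdom c (cparam c u) /\ ccoord c (cparam c u) = u),
      {within cdom c, continuous (ccoord c)} &
      {within cimg c, continuous (cparam c)}].

Definition oriented_atlas (R : realType) (T : topologicalType) m
    (A : set (chart R T m)) : Prop :=
  [/\ (forall c, A c -> is_chart c),
      (forall p : T, exists2 c, A c & cdom c p) &
      forall c c', A c -> A c' ->
        let U := cimg c `&` cparam c @^-1` cdom c' in
        let tau := ccoord c' \o cparam c in
        smooth_on U tau /\ (forall u, U u -> 0 < \det ('J tau u))].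

Definition immersion (R : realType) (T : topologicalType) m
    (A : set (chart R T m)) (F : T -> Cspace R m) : Prop :=
  forall c, A c ->
    smooth_on (cimg c) (F \o cparam c) /\
    (forall u, cimg c u -> injective ('d (F \o cparam c) u)).

(* An oriented real m-dimensional submanifold of C^m, i.e. an oriented smooth
   m-manifold with a smooth immersion [incl_map]; an embedded submanifold is the
   case where [incl_map] is the inclusion of a subspace. *)
Record oriented_submanifold (R : realType) (m : nat) := OrientedSubmanifold {
  carrier :> topologicalType ;
  atlas : set (chart R carrier m) ;
  incl_map : carrier -> Cspace R m ;
  carrier_hausdorff : hausdorff_space carrier ;
  carrier_second_countable : @second_countable carrier ;
  atlas_oriented : oriented_atlas atlas ;
  incl_immersion : immersion atlas incl_map }.
Arguments atlas {R m} M : rename.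
Arguments incl_map {R m} M p : rename.

Section LagrangianGeometry.
Variables (R : realType) (m k : nat) (M : oriented_submanifold R m).
Implicit Types (p : M) (X : Cspace R m) (e : 'I_m -> Cspace R m)
  (Y : M -> Cspace R m).

Definition chart_at p : set (chart R M m) := [set c | atlas M c /\ cdom c p].

(* T_pM, as a subspace of C^m. *)
Definition tangent p : set (Cspace R m) :=
  [set X | exists c (a : 'rV[R]_m),
     chart_at p c /\ 'd (incl_map M \o cparam c) (ccoord c p) a = X].

Definition normal p : set (Cspace R m) :=
  [set N | forall X, tangent p X -> metric k N X = 0].

Definition lagrangian : Prop :=
  (forall p X1 X2, tangent p X1 -> tangent p X2 -> omega k X1 X2 = 0) /\
  (forall p X, tangent p X ->
     (forall X', tangent p X' -> metric k X X' = 0) -> X = 0).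

Definition tangent_basis p e : Prop :=
  (forall j, tangent p (e j)) /\
  (forall X, tangent p X ->
     exists! a : 'rV[R]_m, X = \sum_(j < m) a ord0 j *: e j).

Definition lorentz_basis p e : Prop :=
  tangent_basis p e /\
  (forall j l, metric k (e j) (e l) = if j == l then eps R k j else 0).

(* [row l B] collects the coordinates of e_l in the coordinate frame of an
   oriented chart. *)
Definition positively_oriented p e : Prop :=
  exists c (B : 'M[R]_m),
    [/\ chart_at p c, 0 < \det B &
        forall l, e l = 'd (incl_map M \o cparam c) (ccoord c p) (row l B)].

(* The objects below are defined through [xget], which returns an element of
   the given set when it is nonempty, and 0 otherwise. *)

(* The component of v normal to M at p. *)
Definition normal_part p (v : Cspace R m) : Cspace R m :=
  xget 0 [set N | normal p N /\ tangent p (v - N)].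

(* The flat derivative D_X Y of a vector field Y along M in the direction of
   X in T_pM. *)
Definition flat_derivative p X Y : Cspace R m :=
  xget 0 [set w | exists c (a : 'rV[R]_m),
    [/\ chart_at p c, 'd (incl_map M \o cparam c) (ccoord c p) a = X &
        w = 'D_a (Y \o cparam c) (ccoord c p)]].

Definition tangent_field_near p Y : Prop :=
  exists c, [/\ chart_at p c, smooth_on (cimg c) (Y \o cparam c) &
    forall q, cdom c q -> tangent q (Y q)].

(* h(X, X') = (D_X Y)^perp for any local tangent field Y with Y(p) = X'. *)
Definition second_fundamental_form p X X' : Cspace R m :=
  xget 0 [set w | exists Y, [/\ tangent_field_near p Y, Y p = X' &
    w = normal_part p (flat_derivative p X Y)]].

Definition mean_curvature p : Cspace R m :=
  xget 0 [set w | exists e, lorentz_basis p e /\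
    w = \sum_(j < m) eps R k j *: second_fundamental_form p (e j) (e j)].

Definition minimal : Prop := forall p, mean_curvature p = 0.

(* alpha(TM): the value of an m-form on positively oriented Lorentz bases. *)
Definition form_TM (alpha : ('I_m -> Cspace R m) -> R[i]) p : R[i] :=
  xget 0 [set z | exists e,
    [/\ lorentz_basis p e, positively_oriented p e & z = alpha e]].

Definition dz_TM p : R[i] := form_TM (@dz R m) p.

Definition dz_theta_TM (theta : R) p : R[i] := form_TM (dz_theta theta) p.


End LagrangianGeometry.

(* Main.v *)
(* In a chart, let F be the immersion and d = dz(F_1, ..., F_m) the value of dz on
   the coordinate frame. An oriented Lorentz basis is the coordinate frame times
   a real matrix of positive determinant, and |dz| = 1 on it because the Hermitian
   form metric - i omega is real on a Lagrangian subspace; hence dz(TM) = d / |d|.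
   By Jacobi's formula at a point with Lorentz basis e_j = dF(b_j), the imaginary
   part of the logarithmic derivative of d along a is
   - sum_j eps_j omega(D_a (dF b_j), e_j). Since D_a (dF b_j) = D_{b_j} (dF a) and
   omega vanishes on tangent pairs, this is - omega(H, dF a). So H vanishes iff all
   these imaginary parts do, i.e. iff the phase of d is locally constant. That M
   has index k, so that Lorentz bases exist, is Sylvester's law applied to the
   Hermitian form, for which T_pM is a real form of C^m. *)

Require Import Defs.
From HB Require Import structures.
From mathcomp Require Import all_boot all_order all_algebra.
From mathcomp Require Import all_classical reals topology normedtype derive trigo.
From mathcomp Require Import landau realfun interval_inference.
From mathcomp Require Import complex.
From mathcomp Require Import perm ring.
Import Order.TTheory GRing.Theory Num.Theory.
Import numFieldNormedType.Exports.
Local Open Scope classical_set_scope.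
Local Open Scope ring_scope.
Set Implicit Arguments.
Unset Strict Implicit.
Unset Printing Implicit Defensive.

(** * Symmetric forms and Sylvester's law of inertia *)

Section SymmetricForms.
Variable K : numFieldType.

(** Polarization: if the form vanished on every vector, its value [2 * G i j] on a sum of two
    isotropic basis vectors would vanish too, and 2 is invertible in [K]. *)
Lemma sym_form_nonisotropic n (G : 'M[K]_n) : G^T = G -> G != 0 ->
  exists v : 'rV[K]_n, (v *m G *m v^T) 0 0 != 0.
Proof.
move=> symG; apply: contra_neqP => /forallNP noiso.
have iso (v : 'rV[K]_n) : v *m G *m v^T = 0.
  apply/matrixP => i j; rewrite !ord1 [RHS]mxE.
  by apply/eqP; rewrite -[_ == _]negbK; apply/negP; exact: noiso.
apply/matrixP => i j; rewrite mxE.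
pose u : 'rV[K]_n := delta_mx 0 i; pose w : 'rV[K]_n := delta_mx 0 j.
have uGw : u *m G *m w^T = (G i j)%:M.
  rewrite /u /w trmx_delta -rowE -colE; apply/matrixP => a b.
  by rewrite !ord1 !mxE eqxx.
have wGu : w *m G *m u^T = u *m G *m w^T.
  by rewrite uGw -[RHS]tr_scalar_mx -uGw !trmx_mul trmxK symG mulmxA.
have := iso (u + w); rewrite raddfD /= !mulmxDl !mulmxDr !iso wGu add0r addr0 uGw.
move/matrixP/(_ 0 0); rewrite !mxE eqxx !mulr1n => /eqP.
by rewrite -mulr2n mulrn_eq0 /= => /eqP.
Qed.

(** Lagrange reduction: a non-isotropic vector starts a basis, the nonzero pivot clears its row and
    column, and induction treats the Schur complement. *)
Lemma sym_form_diagonal n (G : 'M[K]_n) : G^T = G ->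
  exists B : 'M[K]_n, exists d : 'rV[K]_n,
    B \in unitmx /\ B *m G *m B^T = diag_mx d.
Proof.
elim: n G => [|n IH] G symG.
  by exists 1%:M, 0; rewrite unitmx1; split=> //; apply/matrixP => -[].
have [->|Gn0] := eqVneq G 0.
  by exists 1%:M, 0; rewrite unitmx1 mulmx0 mul0mx raddf0.
have [v vGv] := sym_form_nonisotropic symG Gn0.
have vn0 : v != 0 by apply: contra_neq vGv => ->; rewrite !mul0mx mxE.
have rv : \rank v = 1%N by rewrite rank_rV vn0.
(* Since [v] has rank 1, [row_ebase v] is an invertible matrix whose first row is proportional to
   [v]: it completes [v] to a basis. *)
pose P := row_ebase v : 'M[K]_(1 + n).
have vP : v = (col_ebase v) 0 0 *: row 0 P.
  rewrite -[LHS](mulmx_ebase v) rv -mulmxA [col_ebase v]mx11_scalar mul_scalar_mx mxE eqxx mulr1n.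
  congr (_ *: _); apply/rowP => j; rewrite !mxE (bigD1 0) //= big1 ?addr0 => [|i i0].
    by rewrite mxE eqxx mul1r.
  have /negbTE h : 0%N != i by rewrite eq_sym.
  by rewrite mxE h mul0r.
have [G' defG'] : exists G' : 'M[K]_(1 + n), G' = P *m G *m P^T by exists (P *m G *m P^T).
have symG' : G'^T = G' by rewrite defG' !trmx_mul trmxK symG mulmxA.
have g0 : G' 0 0 != 0.
  apply: contra_neq vGv => G'0.
  have -> : v *m G *m v^T = ((col_ebase v) 0 0 ^+ 2) *: (row 0 P *m G *m (row 0 P)^T).
    by rewrite {1 2}vP linearZ /= -!scalemxAl -scalemxAr scalerA.
  have rowG' : (row 0 P *m G *m (row 0 P)^T) 0 0 = G' 0 0.
    transitivity (row 0 G' 0 0); last by rewrite mxE.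
    by rewrite defG' !row_mul mxE [RHS]mxE; apply: eq_bigr => k _; rewrite !mxE.
  by rewrite mxE rowG' G'0 mulr0.
pose g := G' 0 0; pose b := ursubmx G'; pose C := drsubmx G'.
have blkG : G' = block_mx g%:M b b^T C.
  rewrite -[LHS]submxK; congr block_mx.
    by rewrite [LHS]mx11_scalar; congr (_%:M); rewrite !mxE /g; congr (G' _ _); exact: val_inj.
  by rewrite /b -[in RHS]symG' trmx_ursub trmxK.
(* Gauss elimination with pivot [g]; congruence by [L] clears both off-diagonal blocks because [G']
   is symmetric. *)
pose L := block_mx 1%:M 0 (- g^-1 *: b^T) 1%:M : 'M[K]_(1 + n).
have [|B1 [d [B1u B1C]]] := IH (C - g^-1 *: (b^T *m b)).
  rewrite raddfB /= linearZ /= trmx_mul trmxK; congr (_ - _).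
  by rewrite /C -[in RHS]symG' trmx_drsub.
pose B2 := block_mx 1%:M 0 0 B1 : 'M[K]_(1 + n).
exists (B2 *m L *m P), (row_mx (g%:M : 'M_1) d); split.
  have uB2 : B2 \in unitmx by rewrite unitmxE det_lblock det1 mul1r -unitmxE.
  have uL : L \in unitmx by rewrite unitmxE det_lblock !det1 mul1r unitr1.
  by rewrite !unitmx_mul row_ebase_unit uB2 uL.
have -> : B2 *m L *m P *m G *m (B2 *m L *m P)^T = B2 *m (L *m G' *m L^T) *m B2^T.
  by rewrite !trmx_mul defG' !mulmxA.
have -> : L *m G' *m L^T = block_mx g%:M 0 0 (C - g^-1 *: (b^T *m b)).
  have -> : L *m G' = block_mx g%:M b 0 (C - g^-1 *: (b^T *m b)).
    rewrite blkG /L !mulmx_block !(mul1mx, mul0mx, addr0).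
    rewrite -!scalemxAl mul_mx_scalar scalerA mulNr mulVf // scaleN1r addNr.
    by rewrite scaleNr addrC.
  rewrite /L tr_block_mx !mulmx_block !(trmx1, trmx0, mulmx1, mulmx0, mul0mx, addr0, add0r).
  by rewrite linearZ /= trmxK -scalemxAr mul_scalar_mx scalerA mulNr mulVf // scaleN1r addNr.
have dE : diag_mx (row_mx (g%:M : 'rV_1) d) = block_mx (diag_mx g%:M) 0 0 (diag_mx d).
  exact: diag_mx_row.
refine (eq_trans _ (esym dE)).
rewrite /B2 tr_block_mx !mulmx_block
  !(trmx1, trmx0, mul1mx, mulmx1, mul0mx, mulmx0, addr0, add0r) B1C.
by congr block_mx; apply/matrixP => i j; rewrite !ord1 !mxE.
Qed.

End SymmetricForms.

(** * Inertia of real diagonal forms under complex congruence *)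

Section Inertia.
Variable R : rcfType.
Local Notation toC := (map_mx (real_complex R)).
Local Notation adj A := ((map_mx (@conjc R) A)^T).

Lemma hermitian_diag_form n (e : 'rV[R]_n) (v : 'rV[R[i]]_n) :
  (v *m diag_mx (toC e) *m adj v) 0 0 =
  \sum_j real_complex R (e 0 j * ((complex.Re (v 0 j)) ^+ 2 + (complex.Im (v 0 j)) ^+ 2)).
Proof.
rewrite mul_mx_diag mxE; apply: eq_bigr => j _; rewrite !mxE.
case: (v 0 j) => a b; simpc => /=.
by congr (Complex _ _); ring.
Qed.

(** With more negative entries in [d] than in [e], some nonzero combination of the rows of [A]
    indexed by [Nd] has zero coordinates on [Ne]. The form is nonnegative on it by [e] and negative
    by [d]. *)
Lemma inertia_le n (A : 'M[R[i]]_n) (e d : 'rV[R]_n) :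
  A *m diag_mx (toC e) *m adj A = diag_mx (toC d) ->
  (#|[set i | (d 0 i < 0)%R]%SET| <= #|[set i | (e 0 i < 0)%R]%SET|)%N.
Proof.
set Nd := [set i | d 0 i < 0]%SET; set Ne := [set i | e 0 i < 0]%SET => Aed.
rewrite leqNgt; apply/negP => lt_ed.
pose f (i : 'I_#|Nd|) : 'I_n := enum_val i.
(* [W] has more rows than columns, hence a nonzero left kernel. *)
pose W := mxsub f (fun j : 'I_#|Ne| => enum_val j) A.
have : kermx W != 0.
  rewrite -mxrank_eq0 mxrank_ker subn_eq0 -ltnNge.
  exact: leq_ltn_trans (rank_leq_col W) lt_ed.
pose c := nz_row (kermx W); rewrite -nz_row_eq0 => c0.
have cW : c *m W = 0 by apply/sub_kermxP; exact: nz_row_sub.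
pose v := c *m rowsub f A.
have vE j : j \in Ne -> v 0 j = 0.
  move=> jN; transitivity ((c *m W) 0 (enum_rank_in jN j)); last by rewrite cW mxE.
  by rewrite !mxE; apply: eq_bigr => i _; rewrite !mxE enum_rankK_in.
have ge0 : 0 <= (v *m diag_mx (toC e) *m adj v) 0 0.
  rewrite hermitian_diag_form sumr_ge0 // => j _; rewrite ler0c.
  have [/vE -> /=|] := boolP (j \in Ne); first by rewrite expr0n addr0 mulr0.
  by rewrite inE -leNgt => ej; rewrite mulr_ge0 // addr_ge0 // sqr_ge0.
have vc : v *m diag_mx (toC e) *m adj v = c *m diag_mx (toC (colsub f d)) *m adj c.
  rewrite /v map_mxM trmx_mul !mulmxA -!mulmxA; congr (_ *m _); rewrite !mulmxA; congr (_ *m _).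
  apply/matrixP => i j.
  transitivity ((A *m diag_mx (toC e) *m adj A) (f i) (f j)).
    rewrite !mxE; apply: eq_bigr => l _; rewrite !mxE; congr (_ * _).
    by apply: eq_bigr => l' _; rewrite !mxE.
  by rewrite Aed !mxE (inj_eq enum_val_inj).
have dneg i : d 0 (f i) < 0 by have := enum_valP i; rewrite inE.
move: ge0; rewrite vc hermitian_diag_form -raddf_sum ler0c.
set S := \sum_i _ => S0.
have tle0 i : d 0 (f i) * (complex.Re (c 0 i) ^+ 2 + complex.Im (c 0 i) ^+ 2) <= 0.
  by rewrite mulr_le0_ge0 ?addr_ge0 ?sqr_ge0 // ltW.
have S00 : - S = 0.
  apply/eqP; rewrite eq_le oppr_le0 S0 /= oppr_ge0 /S.
  by apply: sumr_le0 => i _; rewrite mxE.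
move: S00; rewrite /S -sumrN => /eqP; rewrite psumr_eq0; last first.
  by move=> i _; rewrite oppr_ge0 mxE.
move=> /allP cE; case/negP: c0; apply/eqP/rowP => i; rewrite [RHS]mxE.
have := cE i (mem_index_enum i); rewrite /= mxE oppr_eq0 mulf_eq0 lt_eqF //=.
rewrite paddr_eq0 ?sqr_ge0 // !sqrf_eq0 => /andP[/eqP a /eqP b].
by apply/eqP; rewrite eq_complex a b !eqxx.
Qed.

(** The reverse inequality is [inertia_le] for the opposite forms, whose negative entries are the
    positive ones of [e] and [d], no entry being 0. *)
Lemma inertia n (A : 'M[R[i]]_n) (e d : 'rV[R]_n) :
  A *m diag_mx (toC e) *m adj A = diag_mx (toC d) ->
  (forall i, e 0 i != 0) -> (forall i, d 0 i != 0) ->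
  #|[set i | d 0 i < 0]%SET| = #|[set i | e 0 i < 0]%SET|.
Proof.
move=> Aed e0 d0; apply/eqP; rewrite eqn_leq (inertia_le Aed) /=.
have neg (w : 'rV[R]_n) : (forall i, w 0 i != 0) ->
    #|[set i | w 0 i < 0]%SET| = (n - #|[set i | ((- w) 0 i < 0)%R]%SET|)%N.
  move=> w0; apply/eqP; rewrite -(eqn_add2r #|[set i | ((- w) 0 i < 0)%R]%SET|) subnK; last first.
    by rewrite -[leqRHS]card_ord max_card.
  rewrite -[eqbRHS]card_ord -(cardsC [set i | ((- w) 0 i < 0)%R]%SET) addnC eqn_add2l.
  apply/eqP; apply: eq_card => i.
  by rewrite !inE mxE oppr_lt0 -leNgt le_eqVlt (negbTE (w0 i)).
rewrite (neg e) // (neg d) // leq_sub2l //; apply: (@inertia_le _ A).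
have diagN w : diag_mx (toC (- w)) = - diag_mx (toC w) :> 'M[R[i]]_n.
  by apply/matrixP => i j; rewrite !mxE rmorphN mulNrn.
by rewrite !diagN mulmxN mulNmx Aed.
Qed.

End Inertia.

(** * Lorentz normal form of a real Gram matrix *)

Section LorentzFrame.
Variable R : rcfType.
Local Notation toC := (map_mx (real_complex R)).
Local Notation adj A := ((map_mx (@conjc R) A)^T).

Lemma card_initial n k : (k <= n)%N -> #|[set i : 'I_n | (i < k)%N]%SET| = k.
Proof.
move=> kn; have widen_inj : injective (widen_ord kn) by move=> i j [] /val_inj.
rewrite -[RHS]card_ord -(card_imset _ widen_inj).
apply: eq_card => i; rewrite inE; apply/idP/imsetP => [ik|[j _ ->]] //=.
by exists (Ordinal ik) => //; exact: val_inj.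
Qed.

Lemma initial_reindex n k (N : {set 'I_n}) : #|N| = k ->
  exists f : 'I_n -> 'I_n, injective f /\ forall j, (f j \in N) = (j < k)%N.
Proof.
move=> cN; pose s := enum N ++ enum (~: N).
have us : uniq s.
  rewrite cat_uniq !enum_uniq /= andbT; apply/hasPn => i.
  by rewrite !mem_enum inE.
have ss : size s = n by rewrite size_cat -!cardE cardsC card_ord.
(* The default of [nth] is never returned, as [s] has exactly [n] entries. *)
exists (fun j => nth j s j); split=> [i j|j].
  by move=> /eqP; rewrite (set_nth_default j) ?ss // nth_uniq ?ss // => /eqP /val_inj.
rewrite nth_cat -cardE cN; case: ltnP => jk.
  by rewrite -mem_enum mem_nth // -cardE cN.
apply/negbTE; rewrite -finset.in_setC -mem_enum mem_nth // -cardE.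
by rewrite ltn_subLR // -cN cardsC card_ord.
Qed.

(** A real diagonalization of [G] is complex congruent to [diag_mx e], so inertia gives it exactly
    [k] negative entries; it remains to rescale, reorder and fix the orientation. *)
Lemma lorentz_frame n k (A : 'M[R[i]]_n) (G : 'M[R]_n) : (k <= n)%N ->
  let e : 'rV[R]_n := \row_j (if (j < k)%N then -1 else 1) in
  A *m diag_mx (toC e) *m adj A = toC G -> G^T = G -> G \in unitmx ->
  exists B : 'M[R]_n, 0 < \det B /\ B *m G *m B^T = diag_mx e.
Proof.
move=> kn e AeG symG uG.
have [B [d [uB BGB]]] := sym_form_diagonal symG.
have d0 i : d 0 i != 0.
  have : diag_mx d \in unitmx by rewrite -BGB !unitmx_mul unitmx_tr uB uG.
  by rewrite unitmxE det_diag unitfE prodf_seq_neq0 => /allP /(_ i (mem_index_enum i)).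
have e0 i : e 0 i != 0 by rewrite mxE; case: ifP; rewrite ?oppr_eq0 oner_eq0.
have cd : #|[set i | d 0 i < 0]%SET| = k.
  rewrite (@inertia _ _ (toC B *m A) e d) //; last first.
    rewrite map_mxM trmx_mul !mulmxA -(mulmxA (toC B)) -(mulmxA (toC B)) AeG.
    have -> : adj (toC B) = toC B^T.
      by apply/matrixP => i j; rewrite !mxE conjc_real.
    by rewrite -!map_mxM BGB map_diag_mx.
  rewrite -[RHS](card_initial kn); apply: eq_card => i; rewrite !inE mxE.
  by case: ifP => _; rewrite ?oppr_lt0 ?ltr01 // ltNge ler01.
have [f [finj fN]] := initial_reindex cd.
(* The reindexing [f] puts the negative entries first, and the square roots normalize all entries to
   1 or -1. *)
pose B1 := \matrix_(i, j) ((Num.sqrt `|d 0 (f i)|)^-1 * B (f i) j).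
have B1G : B1 *m G *m B1^T = diag_mx e.
  apply/matrixP => i j.
  have -> : (B1 *m G *m B1^T) i j = (Num.sqrt `|d 0 (f i)|)^-1 * (Num.sqrt `|d 0 (f j)|)^-1 *
      (B *m G *m B^T) (f i) (f j).
    rewrite !mxE big_distrr; apply: eq_bigr => l _ /=; rewrite !mxE !big_distrl big_distrr /=.
    by apply: eq_bigr => l' _; rewrite !mxE; ring.
  rewrite BGB !mxE (inj_eq finj); have [<-|] := eqVneq i j; last by rewrite mulr0n mulr0.
  rewrite !mulr1n -invfM -expr2 sqr_sqrtr // -fN inE.
  by case: ltrgt0P (d0 (f i)) => // h _; rewrite ?mulNr ?invrN ?mulNr mulVf // ?gt_eqF ?lt_eqF.
have uB1 : \det B1 != 0.
  apply/eqP => dB; have := congr1 determinant B1G; rewrite !det_mulmx dB !mul0r.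
  move/esym/eqP; rewrite det_diag prodf_seq_eq0 => /hasP[i _ /=].
  by rewrite (negbTE (e0 i)).
have [dB|dB] := ltrP 0 (\det B1); first by exists B1.
case: n => [|n] in A G kn e AeG symG uG B d uB BGB d0 e0 cd f finj fN B1 B1G uB1 dB *.
  by move: dB; rewrite det_mx00 ler10.
(* Negating the first row turns the negative determinant positive and keeps the diagonal Gram
   matrix. *)
pose s : 'rV[R]_n.+1 := \row_j (if j == 0 then -1 else 1).
exists (diag_mx s *m B1); split.
  rewrite det_mulmx det_diag big_ord_recl big1 => [|i _]; last by rewrite mxE.
  by rewrite mxE eqxx mulr1 mulN1r oppr_gt0 lt_neqAle uB1.
rewrite trmx_mul tr_diag_mx !mulmxA -(mulmxA (diag_mx s)) -(mulmxA (diag_mx s)) B1G.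
rewrite !mulmx_diag; congr diag_mx; apply/rowP => j; rewrite !mxE.
by case: ifP => _; rewrite ?mulr1 ?mul1r // mulrN1 mulN1r opprK.
Qed.

End LorentzFrame.

(** * Calculus in normed spaces *)

Section Germs.
Variables (R : realType) (V W : normedModType R).
Implicit Types f g : V -> W.

Lemma near0_differentiable f x : (\near x, f x = 0) ->
  differentiable f x /\ ('d f x = 0 :> (V -> W)).
Proof.
move=> f0.
have fx0 : f x = 0 := nbhs_singleton f0.
have e : f \o shift x = cst (f x) + (0 : V -> W) +o_ 0 id.
  apply/eqaddoP => _/posnumP[eps]; near=> h.
  have -> : (f \o shift x - (cst (f x) + (0 : V -> W))) h = 0.
    rewrite -[LHS]/(f (h + x) - (f x + 0)) fx0 addr0 subr0.
    near: h; move: f0; rewrite (near_shift 0 x) /=.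
    by apply: filterS => z /=; rewrite subr0.
  by rewrite normr0 mulr_ge0.
have d0 : 'd f x = 0 :> (V -> W).
  by apply: (@diff_unique _ _ _ _ (\0 : {linear V -> W})) => //; exact: cst_continuous.
split=> //; apply/diff_locallyP; split; last by rewrite d0.
by rewrite d0; exact: cst_continuous.
Unshelve. all: by end_near. Qed.

(** The difference [g - f] is zero near [x], so it adds a zero differential to that of [f]. *)
Lemma near_eq_diff f g x : (\near x, f x = g x) -> differentiable f x ->
  differentiable g x /\ ('d g x = 'd f x :> (V -> W)).
Proof.
move=> fg df.
have [|dh h0] := @near0_differentiable (g - f) x.
  by near do rewrite /GRing.add /= /GRing.opp /=; near=> y; apply/eqP; rewrite subr_eq0 eq_sym;
    apply/eqP; near: y.
have -> : g = f + (g - f) by rewrite addrC subrK.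
split; first exact: differentiableD.
apply: (eq_trans (diffD df dh)); apply/funext => v.
by transitivity ('d f x v + 0); [congr (_ + _); exact: (congr1 (@^~ v) h0)|exact: addr0].
Unshelve. all: by end_near. Qed.

Lemma diff_eq_on (U : set V) f g u : open U -> U u ->
  (forall y, U y -> f y = g y) -> differentiable f u ->
  differentiable g u /\ ('d g u = 'd f u :> (V -> W)).
Proof.
move=> oU Uu fg; apply: near_eq_diff.
by near=> y; apply: fg; near: y; exact: open_nbhs_nbhs.
Unshelve. all: by end_near. Qed.

Lemma Cr_on_eq r (U : set V) f g : open U -> (forall y, U y -> f y = g y) ->
  Cr_on r U f -> Cr_on r U g.
Proof.
move=> oU; elim: r f g => [|r IH] f g fg /=.
  move=> cf u Uu; have := cf u Uu; rewrite /prop_for /continuous_at -fg //.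
  apply: cvg_trans; apply: near_eq_cvg.
  by near=> y; apply: fg; near: y; exact: open_nbhs_nbhs.
move=> [df cf]; split=> [u Uu|v].
  by have [] := diff_eq_on oU Uu fg (df u Uu).
apply: IH (cf v) => u Uu.
by have [_ ->] := diff_eq_on oU Uu fg (df u Uu).
Unshelve. all: by end_near. Qed.

End Germs.

(** * Chain rules for linear maps, lines and germs *)

Section LinearMaps.
Variables (R : realType) (U V W : normedModType R).

Lemma is_derive_linear_comp (L : {linear V -> W}) (f : U -> V) (u a : U) :
  continuous L -> differentiable f u ->
  is_derive u a (L \o f) (L ('d f u a)).
Proof.
move=> cL df.
have dL : differentiable L (f u) by exact: linear_differentiable.
have dLf : differentiable (L \o f) u by exact: differentiable_comp.
apply: DeriveDef; first exact: diff_derivable.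
by rewrite deriveE // diff_comp //= diff_lin.
Qed.

Lemma diff_linear_comp (L : {linear V -> W}) (f : U -> V) (u : U) :
  continuous L -> differentiable f u ->
  differentiable (L \o f) u /\ ('d (L \o f) u = L \o 'd f u :> (U -> W)).
Proof.
move=> cL df.
have dL : differentiable L (f u) by exact: linear_differentiable.
split; first exact: differentiable_comp.
by rewrite diff_comp // diff_lin.
Qed.

Lemma diff_is_derive (f : V -> W) (u a : V) : differentiable f u ->
  is_derive u a f ('d f u a).
Proof.
by move=> df; apply: DeriveDef; [exact: diff_derivable|exact: deriveE].
Qed.

Lemma is_derive_near0 (f : V -> W) (u a : V) (df : W) :
  (\near u, f u = 0) -> is_derive u a f df -> df = 0.
Proof.
move=> f0 fd; have [_ <-] := near_eq_is_derive (g := cst 0) f0 fd.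
exact: derive_cst.
Qed.

Lemma is_derive_line (f : V -> W) (u a : V) (t : R) (df : W) :
  is_derive (u + t *: a) a f df -> is_derive t 1 (fun s : R => f (u + s *: a)) df.
Proof.
move=> [dfa <-].
have quotient : (fun h : R => h^-1 *: (((fun s : R => f (u + s *: a)) \o shift t) (h *: 1)
      - f (u + t *: a))) =
    (fun h : R => h^-1 *: ((f \o shift (u + t *: a)) (h *: a) - f (u + t *: a))).
  apply/funext => h /=; congr (_ *: (f _ - _)).
  by rewrite scalerDl addrCA [h%:A]mulr1.
by apply: DeriveDef; rewrite /derivable /derive quotient.
Qed.

Lemma near_diff_comp (tau : U -> V) (f : V -> W) (g : U -> W) (u : U) :
  differentiable tau u -> differentiable f (tau u) ->
  (\near u, f (tau u) = g u) ->
  differentiable g u /\ forall a, 'd g u a = 'd f (tau u) ('d tau u a).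
Proof.
move=> dtau df fg.
have dft : differentiable (f \o tau) u by exact: differentiable_comp.
have [dg e] := @near_eq_diff _ _ _ (f \o tau) g u fg dft.
split=> // a; transitivity ('d (f \o tau) u a); first exact: (congr1 (@^~ a) e).
exact: (congr1 (@^~ a) (diff_comp dtau df)).
Qed.

End LinearMaps.

(** * Mean value theorem and symmetry of mixed second derivatives *)

Section MeanValue.
Variables (R : realType) (V : normedModType R).
Implicit Types (f : V -> R) (u a b : V).

Lemma mean_value (g dg : R -> R) (h : R) : 0 < h ->
  (forall t, 0 <= t <= h -> is_derive t 1 g (dg t)) ->
  exists2 t, 0 <= t <= h & g h - g 0 = dg t * h.
Proof.
move=> h0 gd.
have [x||x] := @MVT R g dg 0 h h0.
- by rewrite in_itv /= => /andP[/ltW x0 /ltW xh]; apply: gd; rewrite x0.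
- apply: derivable_within_continuous => x; rewrite in_itv /= => xh.
  by have [] := gd x xh.
- rewrite in_itv /= => /andP[/ltW x0 /ltW xh] ->.
  by exists x; rewrite ?x0 // subr0.
Qed.

Lemma near_parallelogram u a b (P : set V) : nbhs u P ->
  exists2 h : R, 0 < h & forall s t, 0 <= s <= h -> 0 <= t <= h ->
    P (u + s *: a + t *: b).
Proof.
move=> /nbhs_ballP[r /= r0 rP].
have c0 : 0 < `|a| + `|b| + 1 by rewrite ltr_wpDl // addr_ge0.
(* The summand 1 keeps the denominator positive and makes the final bound by [r] strict. *)
exists (r / (`|a| + `|b| + 1)) => [|s t /andP[s0 sh] /andP[t0 th]].
  by rewrite divr_gt0.
apply: rP; rewrite -ball_normE /= -addrA opprD addrA subrr add0r normrN.
apply: le_lt_trans (ler_normD _ _) _; rewrite !normrZ !ger0_norm //.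
apply: (@le_lt_trans _ _ (r / (`|a| + `|b| + 1) * (`|a| + `|b|))).
  by rewrite mulrDr lerD // ler_wpM2r.
by rewrite mulrAC -mulrA gtr_pMr // ltr_pdivrMr // mul1r ltrDl.
Qed.

(** The mean value theorem is applied twice: in [s] to the increment of [f] by [h *: b], then in [t]
    to the derivative of [f] along [a]. *)
Lemma second_difference f u a b (h : R) : 0 < h ->
  (forall s t, 0 <= s <= h -> 0 <= t <= h ->
     differentiable f (u + s *: a + t *: b) /\
     differentiable (fun y => 'd f y a) (u + s *: a + t *: b)) ->
  exists s t, [/\ 0 <= s <= h, 0 <= t <= h &
    f (u + h *: a + h *: b) - f (u + h *: a) - f (u + h *: b) + f u =
    'd (fun y => 'd f y a) (u + s *: a + t *: b) b * h * h].
Proof.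
move=> h0 fd.
have hh : 0 <= h <= h by rewrite lexx ltW.
have zh : 0 <= (0 : R) <= h by rewrite lexx ltW.
have [s sh|s sh] := @mean_value (fun s => f (u + h *: b + s *: a) - f (u + s *: a))
  (fun s => 'd f (u + s *: a + h *: b) a - 'd f (u + s *: a + 0 *: b) a) h h0.
  apply: is_deriveB.
    rewrite addrAC; apply: (@is_derive_line _ _ _ f); apply: diff_is_derive.
    by rewrite addrAC; have [] := fd s h sh hh.
  rewrite scale0r addr0; apply: (@is_derive_line _ _ _ f); apply: diff_is_derive.
  by have [] := fd s 0 sh zh; rewrite scale0r addr0.
move=> e1.
have [t th|t th e2] := @mean_value (fun t => 'd f (u + s *: a + t *: b) a)
  (fun t => 'd (fun y => 'd f y a) (u + s *: a + t *: b) b) h h0.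
  by apply: (@is_derive_line _ _ _ (fun y => 'd f y a)); apply: diff_is_derive;
    have [] := fd s t sh th.
exists s, t; split=> //; move: e2; rewrite scale0r addr0 => e2; move: e1;
  rewrite !scale0r !addr0 => e1; rewrite -e2 -e1 [u + h *: b + _]addrAC. ring.
Qed.

(** The second difference is symmetric in [a] and [b], so the two mixed derivatives take a common
    value at points arbitrarily close to [u]; continuity at [u] concludes. *)
Lemma schwarz f u a b :
  (\near u, differentiable f u /\
     differentiable (fun y => 'd f y a) u /\
     differentiable (fun y => 'd f y b) u) ->
  {for u, continuous (fun x => 'd (fun y => 'd f y a) x b)} ->
  {for u, continuous (fun x => 'd (fun y => 'd f y b) x a)} ->
  'd (fun y => 'd f y a) u b = 'd (fun y => 'd f y b) u a.
Proof.
move=> fd cab cba; apply/eqP; rewrite -subr_eq0; apply/negPn/negP => ne.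
pose A x := 'd (fun y => 'd f y a) x b.
pose B x := 'd (fun y => 'd f y b) x a.
(* No number lies within less than half the gap of both [A u] and [B u]. *)
have e0 : 0 < `|A u - B u| / 2 by rewrite divr_gt0 // normr_gt0.
have /cvgrPdist_lt/(_ _ e0) nA : A x @[x --> u] --> (A u) by exact: cab.
have /cvgrPdist_lt/(_ _ e0) nB : B x @[x --> u] --> (B u) by exact: cba.
have [h h0 hP] := near_parallelogram a b (filterI fd (filterI nA nB)).
have [h1 h1_ h1P] := near_parallelogram b a (filterI fd (filterI nA nB)).
(* One step length for both orders of the directions, so that the two second differences
   coincide. *)
pose l := Num.min h h1.
have l0 : 0 < l by rewrite lt_min h0.
have lh s : 0 <= s <= l -> (0 <= s <= h) * (0 <= s <= h1).
  by case/andP=> -> /=; rewrite le_min => /andP[-> ->].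
have [|s [t [/lh[sh _] /lh[th _] e1]]] := @second_difference f u a b l l0.
  by move=> s t /lh[sh _] /lh[th _]; have [[? []]] := hP s t sh th.
have [|s' [t' [/lh[_ sh'] /lh[_ th'] e2]]] := @second_difference f u b a l l0.
  by move=> s' t' /lh[_ sh'] /lh[_ th']; have [[? []]] := h1P s' t' sh' th'.
have [_ [/= AA _]] := hP _ _ sh th.
have [_ [_ /= BB]] := h1P _ _ sh' th'.
have AB : A (u + s *: a + t *: b) = B (u + s' *: b + t' *: a).
  have ln0 : l != 0 by rewrite gt_eqF.
  apply: (mulIf ln0); apply: (mulIf ln0).
  by rewrite /A /B -e1 -e2 (addrAC u); ring.
move: AA BB; rewrite AB; set z := B _ => AA BB.
have := ler_normD (A u - z) (z - B u); rewrite addrA subrK (distrC z) leNgt.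
by rewrite [ltRHS]splitr ltrD.
Qed.
End MeanValue.

(** * Real directional derivatives of complex-valued functions, up to Jacobi's formula *)

Section ComplexDerivatives.
Variables (R : realType) (V : normedModType R).
Implicit Types (x v : V) (f g : V -> R[i]).

Lemma is_derive_big (I : Type) (s : seq I) (P : pred I) (h : I -> V -> R) (dh : I -> R) x v :
  (forall i, is_derive x v (h i) (dh i)) ->
  is_derive x v (fun y => \sum_(i <- s | P i) h i y) (\sum_(i <- s | P i) dh i).
Proof.
move=> hd; elim: s => [|i s IH].
  rewrite big_nil (_ : (fun _ => _) = cst 0); first exact: is_derive_cst.
  by apply/funext => y; rewrite big_nil.
rewrite big_cons; case: ifPn => Pi.
  rewrite (_ : (fun _ => _) = h i + (fun y => \sum_(i <- s | P i) h i y)).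
    exact: is_deriveD.
  by apply/funext => y; rewrite big_cons Pi.
rewrite (_ : (fun _ => _) = (fun y => \sum_(i <- s | P i) h i y)) //.
by apply/funext => y; rewrite big_cons (negbTE Pi).
Qed.

Lemma is_derive_mul (f g : V -> R) (df dg : R) x v :
  is_derive x v f df -> is_derive x v g dg ->
  is_derive x v (fun y => f y * g y) (f x * dg + df * g x).
Proof.
move=> fd gd; apply: (is_derive_eq (is_deriveM fd gd)).
by rewrite [X in _ + X]mulrC.
Qed.

Lemma is_derive_inv (f : V -> R) (df : R) x v : f x != 0 ->
  is_derive x v f df -> is_derive x v (fun y => (f y)^-1) (- (f x) ^- 2 * df).
Proof.
move=> fx0 [fd <-]; apply: DeriveDef; first exact: derivableV.
exact: deriveV.
Qed.

Definition is_cderive x v f (df : R[i]) :=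
  is_derive x v (fun y => complex.Re (f y)) (complex.Re df) /\
  is_derive x v (fun y => complex.Im (f y)) (complex.Im df).

Lemma is_cderive_cst x v (c : R[i]) : is_cderive x v (fun=> c) 0.
Proof. by split; exact: is_derive_cst. Qed.

Lemma complex_ReD (a b : R[i]) : complex.Re (a + b) = complex.Re a + complex.Re b.
Proof. by case: a b => [? ?] [? ?]. Qed.

Lemma complex_ImD (a b : R[i]) : complex.Im (a + b) = complex.Im a + complex.Im b.
Proof. by case: a b => [? ?] [? ?]. Qed.

Lemma complex_ReM (a b : R[i]) : complex.Re (a * b) =
  complex.Re a * complex.Re b - complex.Im a * complex.Im b.
Proof. by case: a b => [? ?] [? ?]. Qed.

Lemma complex_ImM (a b : R[i]) : complex.Im (a * b) =
  complex.Re a * complex.Im b + complex.Im a * complex.Re b.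
Proof. by case: a b => [? ?] [? ?]. Qed.

Lemma is_cderiveM x v f g df dg : is_cderive x v f df -> is_cderive x v g dg ->
  is_cderive x v (fun y => f y * g y) (f x * dg + df * g x).
Proof.
move=> [fr fi] [gr gi]; split.
  rewrite (_ : (fun _ => _) = (fun y => complex.Re (f y) * complex.Re (g y)) -
    (fun y => complex.Im (f y) * complex.Im (g y))).
    apply: (is_derive_eq (is_deriveB (is_derive_mul fr gr) (is_derive_mul fi gi))).
    by rewrite complex_ReD !complex_ReM; ring.
  by apply/funext => y; rewrite complex_ReM.
rewrite (_ : (fun _ => _) = (fun y => complex.Re (f y) * complex.Im (g y)) +
    (fun y => complex.Im (f y) * complex.Re (g y))).
  apply: (is_derive_eq (is_deriveD (is_derive_mul fr gi) (is_derive_mul fi gr))).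
  by rewrite complex_ImD !complex_ImM; ring.
by apply/funext => y; rewrite complex_ImM.
Qed.

(** A constant factor does not change the logarithmic derivative [t]. This serves to pass from a
    frame with constant coefficients to the coordinate frame. *)
Lemma is_cderive_unscale x v f g (c t : R[i]) : c != 0 -> (forall y, f y = c * g y) ->
  is_cderive x v f (f x * t) -> is_cderive x v g (g x * t).
Proof.
move=> c0 fg fd; have := is_cderiveM (is_cderive_cst x v c^-1) fd.
rewrite mul0r addr0 fg -[c * g x * t]mulrA mulKf //.
rewrite (_ : (fun y => c^-1 * f y) = g) //.
by apply/funext => y; rewrite fg mulKf.
Qed.

Lemma is_cderive_sum (I : Type) (s : seq I) (f : I -> V -> R[i]) (df : I -> R[i]) x v :
  (forall i, is_cderive x v (f i) (df i)) ->
  is_cderive x v (fun y => \sum_(i <- s) f i y) (\sum_(i <- s) df i).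
Proof.
move=> fd; split; rewrite raddf_sum.
  rewrite (_ : (fun _ => _) = (fun y => \sum_(i <- s) complex.Re (f i y))).
    by apply: is_derive_big => i; have [] := fd i.
  by apply/funext => y; rewrite raddf_sum.
rewrite (_ : (fun _ => _) = (fun y => \sum_(i <- s) complex.Im (f i y))).
  by apply: is_derive_big => i; have [] := fd i.
by apply/funext => y; rewrite raddf_sum.
Qed.

(** Leibniz rule; [uniq s] ensures that the condition [j != i] removes exactly one factor. *)
Lemma is_cderive_prod (I : eqType) (s : seq I) (f : I -> V -> R[i]) (df : I -> R[i]) x v :
  uniq s -> (forall i, is_cderive x v (f i) (df i)) ->
  is_cderive x v (fun y => \prod_(i <- s) f i y)
    (\sum_(i <- s) df i * \prod_(j <- s | j != i) f j x).
Proof.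
move=> us fd; elim: s us => [_|a s IH /= /andP[as_ us]].
  rewrite big_nil (_ : (fun _ => _) = fun=> 1); first exact: is_cderive_cst.
  by apply/funext => y; rewrite big_nil.
have -> : (fun y => \prod_(i <- a :: s) f i y) = (fun y => f a y * \prod_(i <- s) f i y).
  by apply/funext => y; rewrite big_cons.
have -> : \sum_(i <- a :: s) df i * \prod_(j <- a :: s | j != i) f j x =
    f a x * (\sum_(i <- s) df i * \prod_(j <- s | j != i) f j x) +
    df a * \prod_(j <- s) f j x.
  rewrite big_cons addrC; congr (_ + _ * _).
    rewrite big_distrr /= !big_seq; apply: eq_bigr => i si.
    by rewrite big_cons ifT; [ring|apply: contraNneq as_ => ->].
  rewrite big_cons eqxx /= big_seq_cond [RHS]big_seq_cond; apply: eq_bigl => j.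
  have [sj|//] := boolP (j \in s); first by rewrite (contraNneq _ as_) // => <-.
exact: is_cderiveM (fd a) (IH us).
Qed.

(** Jacobi's formula, from differentiating the permutation expansion term by term. *)
Lemma is_cderive_det n (A : V -> 'M[R[i]]_n) (dA : 'M[R[i]]_n) x v :
  (forall i j, is_cderive x v (fun y => A y i j) (dA i j)) ->
  is_cderive x v (fun y => \det (A y)) (\tr (dA *m \adj (A x))).
Proof.
move=> Ad.
have -> : \tr (dA *m \adj (A x)) = \sum_(s : 'S_n)
    (-1) ^+ s * (\sum_i dA i (s i) * \prod_(j | j != i) A x j (s j)).
  (* Both sides are the sum over [i] of the determinant of [A x] with row [i] taken from [dA]:
     cofactor expansion along that row gives the trace, the permutation expansion gives the other
     side. *)
  rewrite /mxtrace; transitivity (\sum_i \det (\matrix_(a, b) if a == i then dA a b else A x a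
    b)); last first.
    apply: esym; rewrite /determinant exchange_big /=; apply: eq_bigr => s _.
    rewrite big_distrr; apply: eq_bigr => i _ /=; congr (_ * _).
    rewrite [RHS](bigD1 i) //= mxE eqxx; congr (_ * _).
    by apply: eq_bigr => j /negbTE ji; rewrite mxE ji.
  apply: eq_bigr => i _; rewrite mxE (expand_det_row _ i); apply: eq_bigr => j _.
  rewrite mxE [in RHS]mxE eqxx; congr (_ * (_ * \det _)).
  by apply/matrixP => a b; rewrite !mxE eq_sym (negbTE (neq_lift _ _)).
apply: is_cderive_sum => s.
have := is_cderiveM (is_cderive_cst x v ((-1) ^+ s))
  (@is_cderive_prod _ (index_enum 'I_n) (fun i y => A y i (s i)) (fun i => dA i (s i)) x v
    (index_enum_uniq _) (fun i => Ad i (s i))).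
by rewrite mul0r addr0.
Qed.

End ComplexDerivatives.

(** * Real coordinates of C^m and derivatives of coordinate expressions *)

Section Coordinates.
Variables (R : realType) (m : nat).

Definition re_coord (j : 'I_m) (X : Cspace R m) : R := X.1 ord0 j.
Definition im_coord (j : 'I_m) (X : Cspace R m) : R := X.2 ord0 j.

Fact re_coord_linear j : linear (re_coord j).
Proof. by move=> c X Z; rewrite /re_coord !mxE. Qed.
HB.instance Definition _ j := GRing.isLinear.Build _ _ _ _ _ (re_coord_linear j).

Fact im_coord_linear j : linear (im_coord j).
Proof. by move=> c X Z; rewrite /im_coord !mxE. Qed.
HB.instance Definition _ j := GRing.isLinear.Build _ _ _ _ _ (im_coord_linear j).

Lemma re_coord_continuous j : continuous (re_coord j).
Proof.
move=> X; apply: (@continuous_comp _ _ _ fst (fun Z : 'rV[R]_m => Z ord0 j)).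
  exact: cvg_fst.
exact: coord_continuous.
Qed.

Lemma im_coord_continuous j : continuous (im_coord j).
Proof.
move=> X; apply: (@continuous_comp _ _ _ snd (fun Z : 'rV[R]_m => Z ord0 j)).
  exact: cvg_snd.
exact: coord_continuous.
Qed.

Lemma coord_inj (X X' : Cspace R m) :
  (forall j, re_coord j X = re_coord j X') ->
  (forall j, im_coord j X = im_coord j X') -> X = X'.
Proof.
case: X X' => [x y] [x' y'] /= re im.
by congr pair; apply/rowP => j; [exact: re|exact: im].
Qed.

End Coordinates.

Section CoordinateDerivatives.
Variables (R : realType) (V : normedModType R) (m k : nat).
Implicit Types (Y W : V -> Cspace R m) (u a : V).

Lemma is_derive_re_coord Y u a j : differentiable Y u ->
  is_derive u a (fun y => (Y y).1 ord0 j) (('d Y u a).1 ord0 j).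
Proof. by move=> dY; exact: (is_derive_linear_comp a (@re_coord_continuous _ _ j) dY). Qed.

Lemma is_derive_im_coord Y u a j : differentiable Y u ->
  is_derive u a (fun y => (Y y).2 ord0 j) (('d Y u a).2 ord0 j).
Proof. by move=> dY; exact: (is_derive_linear_comp a (@im_coord_continuous _ _ j) dY). Qed.

Lemma is_cderive_zcoord Y u a j : differentiable Y u ->
  is_cderive u a (fun y => zcoord (Y y) j) (zcoord ('d Y u a) j).
Proof.
by move=> dY; split; [exact: is_derive_re_coord|exact: is_derive_im_coord].
Qed.

Lemma is_derive_omega Y W u a : differentiable Y u -> differentiable W u ->
  is_derive u a (fun y => omega k (Y y) (W y))
    (omega k ('d Y u a) (W u) + omega k (Y u) ('d W u a)).
Proof.
move=> dY dW; rewrite /omega -big_split /=; apply: is_derive_big => j.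
have d := is_deriveB (is_derive_mul (is_derive_re_coord a j dY) (is_derive_im_coord a j dW))
   (is_derive_mul (is_derive_im_coord a j dY) (is_derive_re_coord a j dW)).
apply: (is_derive_eq (is_derive_mul (is_derive_cst _ _ _) d)).
by rewrite mul0r addr0 -mulrDr opprD addrACA addrC.
Qed.

End CoordinateDerivatives.

Section SchwarzVector.
Variables (R : realType) (V W : normedModType R).

(** Composition with a continuous functional commutes with differentials, so the scalar case applies
    to [L \o F]; coordinate functionals then yield the vector case. *)
Lemma schwarz_linear (L : {linear W -> R}) (F : V -> W) (U : set V) u a b :
  continuous L -> open U -> U u -> Cr_on 2 U F ->
  L ('d (fun y => 'd F y a) u b) = L ('d (fun y => 'd F y b) u a).
Proof.
move=> cL oU Uu [dF d2F].
have dLF y : U y -> differentiable (L \o F) y /\ ('d (L \o F) y = L \o 'd F y :> (V -> R)).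
  by move=> Uy; exact: diff_linear_comp (dF y Uy).
have dLdF v y : U y -> differentiable (fun y => 'd (L \o F) y v) y /\
    ('d (fun y => 'd (L \o F) y v) y = L \o 'd (fun y => 'd F y v) y :> (V -> R)).
  move=> Uy; have [d2Fv _] := d2F v.
  have [dL2 e2] := diff_linear_comp cL (d2Fv y Uy).
  have LE z : U z -> (L \o (fun y => 'd F y v)) z = 'd (L \o F) z v.
    by move=> Uz; have [_ ->] := dLF z Uz.
  by have [? ->] := diff_eq_on oU Uy LE dL2; split.
have cd2 v w : {for u, continuous (fun x => 'd (fun y => 'd (L \o F) y v) x w)}.
  have [_ /(_ w) c2] := d2F v.
  have : {for u, continuous (L \o (fun x => 'd (fun y => 'd F y v) x w))}.
    by apply: continuous_comp; [exact: c2|exact: cL].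
  rewrite /prop_for /continuous_at /= => cc.
  have [_ ->] := dLdF v u Uu.
  apply: cvg_trans cc; apply: near_eq_cvg; near=> y.
  have Uy : U y by near: y; exact: open_nbhs_nbhs.
  by have [_ ->] := dLdF v y Uy.
have [_ /(congr1 (@^~ b)) /= <-] := dLdF a u Uu.
have [_ /(congr1 (@^~ a)) /= <-] := dLdF b u Uu.
apply: schwarz => //; near=> y.
have Uy : U y by near: y; exact: open_nbhs_nbhs.
by split; [case: (dLF y Uy)|split; [case: (dLdF a y Uy)|case: (dLdF b y Uy)]].
Unshelve. all: by end_near. Qed.

End SchwarzVector.

Lemma schwarz_Cspace (R : realType) (V : normedModType R) (m : nat)
    (F : V -> Cspace R m) (U : set V) u a b : open U -> U u -> Cr_on 2 U F ->
  'd (fun y => 'd F y a) u b = 'd (fun y => 'd F y b) u a.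
Proof.
move=> oU Uu sF; apply: coord_inj => j.
  exact: (@schwarz_linear R V _ (@re_coord R m j) F U u a b (@re_coord_continuous _ _ j) oU Uu sF).
exact: (@schwarz_linear R V _ (@im_coord R m j) F U u a b (@im_coord_continuous _ _ j) oU Uu sF).
Qed.

(** * Curves in the plane with real logarithmic derivative *)

Section ConstantPhase.
Variable R : realType.

(** The norm of the curve has the same logarithmic derivative [l] as [x] and [y], so the quotient
    has zero derivative. *)
Lemma constant_phase (x y : R -> R) :
  (forall t : R, 0 <= t <= 1 -> exists l : R, [/\ is_derive t 1 x (l * x t),
     is_derive t 1 y (l * y t) & 0 < x t ^+ 2 + y t ^+ 2]) ->
  x 1 / Num.sqrt (x 1 ^+ 2 + y 1 ^+ 2) = x 0 / Num.sqrt (x 0 ^+ 2 + y 0 ^+ 2).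
Proof.
move=> xy.
have [t /xy[l [dx dy N0]]|t _] := @mean_value R
  (fun t => x t / Num.sqrt (x t ^+ 2 + y t ^+ 2)) (fun=> 0) 1 ltr01; last first.
  by move=> /eqP; rewrite mul0r subr_eq0 => /eqP.
pose N s := x s * x s + y s * y s.
have NE s : x s ^+ 2 + y s ^+ 2 = N s by rewrite /N !expr2.
have dN : is_derive t 1 N (2 * l * N t).
  apply: (is_derive_eq (is_deriveD (is_derive_mul dx dx) (is_derive_mul dy dy))).
  by rewrite /N; ring.
rewrite NE in N0.
pose S s := Num.sqrt (N s).
have s0 : S t != 0 by rewrite gt_eqF // sqrtr_gt0.
have dS : is_derive t 1 S (l * S t).
  have ds := is_derive1_sqrt N0.
  apply: (is_derive_eq (is_derive1_comp ds dN)).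
  rewrite -[X in _ * (_ * X)](sqr_sqrtr (ltW N0)) -/(S t).
  by move: (S t) s0 => w w0; field.
have dV := is_derive_inv s0 dS.
rewrite (_ : (fun _ => _) = (fun s => x s * (S s)^-1)); last first.
  by apply/funext => s; rewrite NE.
apply: (is_derive_eq (is_derive_mul dx dV)).
by move: (S t) s0 => w w0; field.
Qed.

(** This is [z / |z|], split into components to which [constant_phase] applies. *)
Definition phase (z : R[i]) : R[i] :=
  let n := Num.sqrt (complex.Re z ^+ 2 + complex.Im z ^+ 2) in
  Complex (complex.Re z / n) (complex.Im z / n).

Lemma complex_constant_phase (f : R -> R[i]) :
  (forall t : R, 0 <= t <= 1 -> exists l : R,
     [/\ is_derive t 1 (fun s => complex.Re (f s)) (l * complex.Re (f t)),
     is_derive t 1 (fun s => complex.Im (f s)) (l * complex.Im (f t)) &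
     0 < complex.Re (f t) ^+ 2 + complex.Im (f t) ^+ 2]) ->
  phase (f 1) = phase (f 0).
Proof.
move=> fd; congr Complex.
  exact: (@constant_phase (fun s => complex.Re (f s)) (fun s => complex.Im (f s)) fd).
have := @constant_phase (fun s => complex.Im (f s)) (fun s => complex.Re (f s)).
rewrite (addrC (complex.Im (f 1) ^+ 2)) (addrC (complex.Im (f 0) ^+ 2));
  apply=> t /fd[l [dre dim N0]].
by exists l; split=> //; rewrite addrC.
Qed.

End ConstantPhase.

(** * Lorentz frames in C^m *)

Section Frames.
Variables (R : realType) (m k : nat).
Implicit Types (X N : Cspace R m) (e : 'I_m -> Cspace R m).
Local Notation toC := (map_mx (real_complex R)).
Local Notation adj A := ((map_mx (@conjc R) A)^T).
Local Notation sgn := (\row_(j < m) (if (j < k)%N then -1 else 1) : 'rV[R]_m).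

Lemma metricC X X' : metric k X X' = metric k X' X.
Proof. by apply: eq_bigr => j _; ring. Qed.

Lemma omegaC X X' : omega k X X' = - omega k X' X.
Proof. by rewrite /omega -sumrN; apply: eq_bigr => j _; ring. Qed.

Lemma metric_linear c X1 X2 X :
  metric k (c *: X1 + X2) X = c * metric k X1 X + metric k X2 X.
Proof.
rewrite /metric big_distrr -big_split; apply: eq_bigr => j _ /=.
by rewrite !mxE; ring.
Qed.

Lemma omega_linear c X1 X2 X :
  omega k (c *: X1 + X2) X = c * omega k X1 X + omega k X2 X.
Proof.
rewrite /omega big_distrr -big_split; apply: eq_bigr => j _ /=.
by rewrite !mxE; ring.
Qed.

Lemma metric0l X : metric k 0 X = 0.
Proof. by rewrite /metric big1 // => j _; rewrite !mxE; ring. Qed.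

Lemma omega0l X : omega k 0 X = 0.
Proof. by rewrite /omega big1 // => j _; rewrite !mxE; ring. Qed.

Lemma metric_suml (a : 'I_m -> R) e X :
  metric k (\sum_j a j *: e j) X = \sum_j a j * metric k (e j) X.
Proof.
elim/big_ind2: _ => [|x1 x2 y1 y2 <- <-|j _]; first exact: metric0l.
  by rewrite -[X in X + _]scale1r metric_linear mul1r.
by rewrite -[_ *: _]addr0 metric_linear metric0l addr0.
Qed.

Lemma omega_suml (a : 'I_m -> R) e X :
  omega k (\sum_j a j *: e j) X = \sum_j a j * omega k (e j) X.
Proof.
elim/big_ind2: _ => [|x1 x2 y1 y2 <- <-|j _]; first exact: omega0l.
  by rewrite -[X in X + _]scale1r omega_linear mul1r.
by rewrite -[_ *: _]addr0 omega_linear omega0l addr0.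
Qed.

Lemma metricBl X1 X2 X : metric k (X1 - X2) X = metric k X1 X - metric k X2 X.
Proof. by rewrite addrC -scaleN1r metric_linear mulN1r addrC. Qed.

Lemma omegaBl X1 X2 X : omega k (X1 - X2) X = omega k X1 X - omega k X2 X.
Proof. by rewrite addrC -scaleN1r omega_linear mulN1r addrC. Qed.

Lemma complex_ext (a b : R[i]) : complex.Re a = complex.Re b ->
  complex.Im a = complex.Im b -> a = b.
Proof. by case: a b => [? ?] [? ?] /= -> ->. Qed.

(** The Hermitian form of signature [eps], linear in the first argument and conjugate linear in the
    second; it is real on Lagrangian subspaces. *)
Definition herm X X' : R[i] := Complex (metric k X X') (- omega k X X').

Lemma hermE X X' : herm X X' =
  \sum_j zcoord X j * real_complex R (eps R k j) * conjc (zcoord X' j).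
Proof.
apply: complex_ext; rewrite raddf_sum /= /metric /omega -?sumrN; apply: eq_bigr => j _.
  by rewrite /eps; case: ifP => _ /=; ring.
by rewrite /eps; case: ifP => _ /=; ring.
Qed.

(** Transposed with respect to the matrix in [dz]: vectors are rows, so a change of frame is a left
    multiplication. *)
Definition frame_mx e : 'M[R[i]]_m := \matrix_(l, j) zcoord (e l) j.

Lemma dzE e : dz e = \det (frame_mx e).
Proof. by rewrite -det_tr; congr (\det _); apply/matrixP => i j; rewrite !mxE. Qed.

Lemma frame_gram e :
  frame_mx e *m diag_mx (toC sgn) *m adj (frame_mx e) = \matrix_(a, b) herm (e a) (e b).
Proof.
apply/matrixP => a b; rewrite mul_mx_diag !mxE hermE.
by apply: eq_bigr => j _; rewrite !mxE.
Qed.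

Lemma zcoord_sum (I : Type) (s : seq I) (a : I -> R) (e : I -> Cspace R m) j :
  zcoord (\sum_(i <- s) a i *: e i) j = \sum_(i <- s) real_complex R (a i) * zcoord (e i) j.
Proof.
elim/big_ind2: _ => [|x1 x2 y1 y2 <- <-|i _]; apply: complex_ext => /=; rewrite ?mxE //; ring.
Qed.

Lemma frame_linear (L : {linear 'rV[R]_m -> Cspace R m}) (B : 'M[R]_m) :
  frame_mx (fun l => L (row l B)) = toC B *m frame_mx (fun l => L (delta_mx ord0 l)).
Proof.
apply/matrixP => l j; rewrite !mxE.
have -> : L (row l B) = \sum_a B l a *: L (delta_mx ord0 a).
  rewrite [row l B]row_sum_delta (raddf_sum L); apply: eq_bigr => a _.
  by rewrite mxE; exact: linearZ.
by rewrite zcoord_sum; apply: eq_bigr => a _; rewrite !mxE.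
Qed.

Lemma dz_linear (L : {linear 'rV[R]_m -> Cspace R m}) (B : 'M[R]_m) :
  dz (fun l => L (row l B)) =
  real_complex R (\det B) * dz (fun l => L (delta_mx ord0 l)).
Proof. by rewrite !dzE frame_linear det_mulmx det_map_mx. Qed.

(** The two conditions together say that the Gram matrix of [herm] on [e] is the diagonal signature
    matrix. *)
Definition lorentz_frame_vectors e : Prop :=
  (forall j l, metric k (e j) (e l) = if j == l then eps R k j else 0) /\
  (forall j l, omega k (e j) (e l) = 0).

Lemma lorentz_gram e : lorentz_frame_vectors e ->
  frame_mx e *m diag_mx (toC sgn) *m adj (frame_mx e) = diag_mx (toC sgn).
Proof.
move=> [ge oe]; rewrite frame_gram; apply/matrixP => a b.
by rewrite !mxE /herm ge oe oppr0; case: eqVneq => [->|].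
Qed.

Lemma sgn_sq : diag_mx (toC sgn) *m diag_mx (toC sgn) = 1%:M.
Proof.
apply/matrixP => a b; rewrite mulmx_diag !mxE; case: eqVneq => // _.
by case: ifP => _; rewrite -rmorphM /= ?mulrNN mulr1.
Qed.

Lemma sgn_unit : diag_mx (toC sgn) \in unitmx.
Proof. by have := mulmx1_unit sgn_sq => -[]. Qed.

Lemma lorentz_frame_inv e : lorentz_frame_vectors e ->
  frame_mx e *m (diag_mx (toC sgn) *m adj (frame_mx e) *m diag_mx (toC sgn)) = 1%:M.
Proof. by move=> /lorentz_gram Ze; rewrite !mulmxA Ze sgn_sq. Qed.

(** Taking determinants in the Gram identity and cancelling that of the signature matrix leaves
    [dz e] times its conjugate equal to 1. *)
Lemma lorentz_dz_norm e : lorentz_frame_vectors e -> `|dz e| = 1.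
Proof.
move=> /lorentz_gram /(congr1 determinant); rewrite !det_mulmx det_tr det_map_mx dzE.
rewrite mulrAC => h.
have : \det (frame_mx e) * conjc (\det (frame_mx e)) = 1.
  have u : \det (diag_mx (toC sgn)) \is a GRing.unit by rewrite -unitmxE sgn_unit.
  by apply: (mulIr u); rewrite mul1r.
by rewrite -sqr_normc => /eqP; rewrite sqrp_eq1 // => /eqP.
Qed.

(** The hypotheses say that [herm N (e l)] vanishes for all [l], while such a frame is a complex
    basis of C^m and the Hermitian form is non-degenerate. *)
Lemma lorentz_orthogonal_eq0 e N : lorentz_frame_vectors e ->
  (forall l, metric k N (e l) = 0) -> (forall l, omega k N (e l) = 0) -> N = 0.
Proof.
move=> le mN oN; pose n : 'rV[R[i]]_m := \row_j zcoord N j.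
have nZ : n *m (diag_mx (toC sgn) *m adj (frame_mx e) *m diag_mx (toC sgn)) = 0.
  suff : n *m diag_mx (toC sgn) *m adj (frame_mx e) = 0 by rewrite !mulmxA => ->; rewrite mul0mx.
  apply/rowP => l; rewrite mul_mx_diag !mxE.
  transitivity (herm N (e l)); last by rewrite /herm mN oN oppr0.
  by rewrite hermE; apply: eq_bigr => j _; rewrite !mxE.
have /mulmx1C inv := lorentz_frame_inv le.
have n0 : n = 0 by rewrite -[n]mulmx1 -inv mulmxA nZ mul0mx.
apply: coord_inj => j; have := congr1 (fun v : 'rV_m => v ord0 j) n0; rewrite !mxE => -[re im].
  by rewrite /re_coord re mxE.
by rewrite /im_coord im mxE.
Qed.

(** Jacobi's formula, with the adjugate replaced by the determinant times the explicit inverse that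
    the Gram identity provides. The frame has to be Lorentz at [x] only. *)
Lemma lorentz_dz_derive (V : normedModType R) (e : 'I_m -> V -> Cspace R m) (x v : V) :
  (forall l, differentiable (e l) x) -> lorentz_frame_vectors (e ^~ x) ->
  is_cderive x v (fun y => dz (e ^~ y))
    (dz (e ^~ x) * \sum_l real_complex R (eps R k l) * herm ('d (e l) x v) (e l x)).
Proof.
move=> de le.
have -> : (fun y => dz (e ^~ y)) = (fun y => \det (frame_mx (e ^~ y))).
  by apply/funext => y; rewrite dzE.
pose dZ := frame_mx (fun l => 'd (e l) x v).
have dZ_derive i j : is_cderive x v (fun y => frame_mx (e ^~ y) i j) (dZ i j).
  rewrite mxE (_ : (fun _ => _) = fun y => zcoord (e i y) j); first exact: is_cderive_zcoord.
  by apply/funext => y; rewrite mxE.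
have := is_cderive_det dZ_derive.
set A := frame_mx (e ^~ x); pose X := diag_mx (toC sgn) *m adj A *m diag_mx (toC sgn).
have -> : \adj A = \det A *: X.
  have AX : A *m X = 1%:M := lorentz_frame_inv le.
  by rewrite -[LHS]mulmx1 -AX mulmxA mul_adj_mx mul_scalar_mx.
rewrite -scalemxAr linearZ /= dzE -/A.
suff -> : \tr (dZ *m X) = \sum_l real_complex R (eps R k l) * herm ('d (e l) x v) (e l x) by [].
apply: eq_bigr => l _; rewrite hermE mxE big_distrr; apply: eq_bigr => j _ /=.
by rewrite /X mul_mx_diag mul_diag_mx !mxE /eps -[Complex _ (- _)]/(conjc (zcoord (e l x) j)); ring.
Qed.

Lemma linear_row_basis (L : {linear 'rV[R]_m -> Cspace R m}) (B : 'M[R]_m) w :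
  injective L -> B \in unitmx ->
  exists! a : 'rV[R]_m, L w = \sum_j a ord0 j *: L (row j B).
Proof.
move=> injL uB.
have LE (a : 'rV[R]_m) : \sum_j a ord0 j *: L (row j B) = L (a *m B).
  rewrite mulmx_sum_row (raddf_sum L); apply: eq_bigr => j _.
  by apply: esym; exact: linearZ.
exists (w *m invmx B); split; first by rewrite LE mulmxKV.
by move=> a; rewrite LE => /injL ->; rewrite mulmxK.
Qed.

(** The Hermitian Gram matrix of the coordinate frame equals the real matrix [G] because [omega]
    vanishes, and non-degeneracy makes [G] invertible; [lorentz_frame] then applies. *)
Lemma lorentz_exists (L : {linear 'rV[R]_m -> Cspace R m}) : (k <= m)%N ->
  injective L -> (forall a b, omega k (L a) (L b) = 0) ->
  (forall a, (forall b, metric k (L a) (L b) = 0) -> L a = 0) ->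
  exists B : 'M[R]_m, 0 < \det B /\
    forall j l, metric k (L (row j B)) (L (row l B)) = if j == l then eps R k j else 0.
Proof.
move=> km injL omegaL nondeg.
pose E l := L (delta_mx ord0 l); pose G := \matrix_(a, b) metric k (E a) (E b).
have LE (a : 'rV[R]_m) : L a = \sum_j a ord0 j *: E j.
  rewrite [a in L a]row_sum_delta (raddf_sum L); apply: eq_bigr => j _.
  exact: linearZ.
have LG (a b : 'rV[R]_m) : metric k (L a) (L b) = (a *m G *m b^T) ord0 ord0.
  rewrite (LE a) metric_suml -mulmxA mxE; apply: eq_bigr => i _; congr (_ * _).
  rewrite metricC (LE b) metric_suml mxE; apply: eq_bigr => j _.
  by rewrite !mxE mulrC metricC.
have uG : G \in unitmx.
  rewrite -row_free_unit -kermx_eq0; apply/negPn/negP => K0.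
  have : nz_row (kermx G) != 0 by rewrite nz_row_eq0.
  set a := nz_row _ => a0; have aG : a *m G = 0 by apply/sub_kermxP; exact: nz_row_sub.
  have La : L a = 0 by apply: nondeg => b; rewrite LG aG mul0mx mxE.
  by case/eqP: a0; apply: injL; rewrite La (raddf0 L).
have symG : G^T = G by apply/matrixP => a b; rewrite !mxE metricC.
have [|B [dB BG]] := @lorentz_frame R m k (frame_mx E) G km _ symG uG.
  rewrite frame_gram; apply/matrixP => a b; rewrite !mxE /herm.
  by rewrite omegaL oppr0.
exists B; split=> // j l; rewrite LG.
transitivity ((B *m G *m B^T) j l); last first.
  by rewrite BG !mxE /eps; case: eqVneq => [->|].
rewrite tr_row -row_mul !mxE.
by apply: eq_bigr => i _; rewrite !mxE.
Qed.

Lemma phase_pos_mul (z : R[i]) (r : R) : `|z| = 1 -> 0 < r ->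
  phase (z * real_complex R r) = z.
Proof.
case: z => x y; rewrite normc_def => /(congr1 (@complex.Re R)) /= /(congr1 (fun t => t ^+ 2)) xy r0.
rewrite sqr_sqrtr ?addr_ge0 ?sqr_ge0 // expr1n in xy.
have n : (x * r - y * 0) ^+ 2 + (x * 0 + y * r) ^+ 2 = r ^+ 2.
  by rewrite -[RHS]mul1r -xy; ring.
rewrite /phase /= n sqrtr_sqr gtr0_norm //.
have rn0 : r != 0 by rewrite gt_eqF.
by congr Complex; field.
Qed.

End Frames.

(** * Changes of charts *)

Section Charts.
Variables (R : realType) (m : nat) (M : oriented_submanifold R m).
Implicit Types (c : chart R M m) (p : M) (G Y : M -> Cspace R m).
Local Notation F c := (incl_map M \o cparam c).

Lemma atlas_chart c : atlas M c -> is_chart c.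
Proof. by have [+ _ _] := atlas_oriented M; apply. Qed.

Lemma cdom_open c : atlas M c -> open (cdom c).
Proof. by case/atlas_chart => -[]. Qed.

Lemma cimg_open c : atlas M c -> open (cimg c).
Proof. by case/atlas_chart => -[]. Qed.

Lemma ccoord_img c p : atlas M c -> cdom c p -> cimg c (ccoord c p).
Proof. by case/atlas_chart => _ h _ _ _ /h []. Qed.

Lemma ccoordK c p : atlas M c -> cdom c p -> cparam c (ccoord c p) = p.
Proof. by case/atlas_chart => _ h _ _ _ /h []. Qed.

Lemma cparam_dom c u : atlas M c -> cimg c u -> cdom c (cparam c u).
Proof. by case/atlas_chart => _ _ h _ _ /h []. Qed.

Lemma cparamK c u : atlas M c -> cimg c u -> ccoord c (cparam c u) = u.
Proof. by case/atlas_chart => _ _ h _ _ /h []. Qed.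

Lemma chart_exists p : exists2 c, atlas M c & cdom c p.
Proof. by have [_ + _] := atlas_oriented M; apply. Qed.

Lemma cparam_nbhs c u (O : set M) : atlas M c -> cimg c u -> open O ->
  O (cparam c u) -> nbhs u (cparam c @^-1` O).
Proof.
move=> Ac cu oO Ou; have [_ _ _ _] := atlas_chart Ac.
rewrite continuous_open_subspace; last exact: cimg_open.
move=> /(_ u (mem_set cu)); apply; exact: open_nbhs_nbhs.
Qed.

Lemma ccoord_nbhs c p (O : set 'rV[R]_m) : atlas M c -> cdom c p ->
  nbhs (ccoord c p) O -> nbhs p (ccoord c @^-1` O).
Proof.
move=> Ac cp nO; have [_ _ _ + _] := atlas_chart Ac.
rewrite continuous_open_subspace; last exact: cdom_open.
by move=> /(_ p (mem_set cp)); apply.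
Qed.

Lemma incl_smooth c : atlas M c -> smooth_on (cimg c) (F c).
Proof. by move=> /(incl_immersion) []. Qed.

Lemma incl_diff c u : atlas M c -> cimg c u -> differentiable (F c) u.
Proof. by move=> Ac cu; have [+ _] := @incl_smooth _ Ac 1; apply. Qed.

Lemma incl_diff_inj c u : atlas M c -> cimg c u -> injective ('d (F c) u).
Proof. by move=> /(incl_immersion) [_]; apply. Qed.

Lemma incl_diff2 c u a : atlas M c -> cimg c u ->
  differentiable (fun y => 'd (F c) y a) u.
Proof. by move=> Ac cu; have [_ /(_ a) [+ _]] := @incl_smooth _ Ac 2; apply. Qed.

Lemma incl_schwarz c u a b : atlas M c -> cimg c u ->
  'd (fun y => 'd (F c) y a) u b = 'd (fun y => 'd (F c) y b) u a.
Proof.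
move=> Ac cu; exact: (schwarz_Cspace a b (cimg_open Ac) cu (@incl_smooth _ Ac 2)).
Qed.

(** [J] is the Jacobian of the transition map. It is chosen before [G], so one matrix transforms the
    immersion and every field along [M] simultaneously. *)
Lemma chart_change c c' p : atlas M c -> atlas M c' -> cdom c p -> cdom c' p ->
  exists2 J : 'M[R]_m, 0 < \det J &
  forall G, differentiable (G \o cparam c') (ccoord c' p) ->
    differentiable (G \o cparam c) (ccoord c p) /\
    forall a, 'd (G \o cparam c) (ccoord c p) a =
              'd (G \o cparam c') (ccoord c' p) (a *m J).
Proof.
move=> Ac Ac' cp c'p; have [_ _ /(_ c c' Ac Ac') /= [smtau dettau]] := atlas_oriented M.
set u := ccoord c p; pose tau := ccoord c' \o cparam c.
have cu : cimg c u by exact: ccoord_img.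
have ucK : cparam c u = p by exact: ccoordK.
have Uu : (cimg c `&` cparam c @^-1` cdom c') u by split=> //=; rewrite ucK.
exists ('J tau u); first exact: dettau.
have dtau : differentiable tau u by have [+ _] := smtau 1; apply.
have tauu : tau u = ccoord c' p by rewrite /tau /= ucK.
move=> G dG.
have nE : \near u, (G \o cparam c') (tau u) = (G \o cparam c) u.
  have : nbhs u (cparam c @^-1` cdom c').
    by apply: cparam_nbhs => //; [exact: cdom_open|rewrite ucK].
  apply: filterS => y /= c'y.
  by rewrite (ccoordK Ac' c'y).
rewrite -tauu in dG *.
have [dGc dE] := near_diff_comp dtau dG nE.
split; first exact: dGc.
move=> a; have -> : a *m 'J tau u = 'd tau u a by exact: mul_rV_lin1.
exact: dE.
Qed.

Lemma chart_change_tangent c c' p : atlas M c -> atlas M c' -> cdom c p -> cdom c' p ->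
  exists2 J : 'M[R]_m, 0 < \det J & forall a,
    'd (F c) (ccoord c p) a = 'd (F c') (ccoord c' p) (a *m J).
Proof.
move=> Ac Ac' cp c'p; have [J J0 JE] := chart_change Ac Ac' cp c'p.
by exists J => //; have [] := JE _ (incl_diff Ac' (ccoord_img Ac' c'p)).
Qed.

Lemma tangentP c p X : atlas M c -> cdom c p ->
  tangent p X <-> exists a, 'd (F c) (ccoord c p) a = X.
Proof.
move=> Ac cp; split=> [[c' [a [[Ac' c'p] <-]]]|[a <-]]; last by exists c, a.
have [J _ JE] := chart_change_tangent Ac' Ac c'p cp.
by exists (a *m J); exact: esym (JE a).
Qed.

(** The set behind [flat_derivative] is a singleton: another chart changes the direction and the
    derivative by the same Jacobian. *)
Lemma flat_derivativeE c p Y x : atlas M c -> cdom c p -> tangent_field_near p Y ->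
  differentiable (Y \o cparam c) (ccoord c p) /\
  flat_derivative p ('d (F c) (ccoord c p) x) Y = 'd (Y \o cparam c) (ccoord c p) x.
Proof.
move=> Ac cp [cY [[AcY cYp] smY _]].
(* Smoothness of [Y] is given in one chart only; the transition map carries differentiability at [p]
   to the others. *)
have dY c' : atlas M c' -> cdom c' p -> differentiable (Y \o cparam c') (ccoord c' p).
  move=> Ac' c'p; have [J _ JE] := chart_change Ac' AcY c'p cYp.
  have [dY _] := smY 1.
  by have [] := JE Y (dY _ (ccoord_img AcY cYp)).
split; first exact: dY.
apply: xget_unique.
  by exists c, x; split=> //; rewrite deriveE //; exact: dY.
move=> _ [c' [a [[Ac' c'p] ax ->]]].
rewrite deriveE; last exact: dY.
have [J _ JE] := chart_change Ac' Ac c'p cp.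
have [_ YE] := JE _ (dY _ Ac cp).
(* Both coordinate vectors represent the same tangent vector, and the differential of the immersion
   is injective. *)
suff aJ : a *m J = x by exact: eq_trans (YE a) (congr1 ('d (Y \o cparam c) (ccoord c p)) aJ).
have [_ e] := JE _ (incl_diff Ac (ccoord_img Ac cp)).
apply: (incl_diff_inj Ac (ccoord_img Ac cp)).
exact: eq_trans (esym (e a)) ax.
Qed.

Lemma tangent_sum p (I : Type) (s : seq I) (a : I -> R) (X : I -> Cspace R m) :
  (forall i, tangent p (X i)) -> tangent p (\sum_(i <- s) a i *: X i).
Proof.
move=> tX; have [c Ac cp] := chart_exists p.
apply/(tangentP _ Ac cp).
have /choice[x xE] i : exists x, 'd (F c) (ccoord c p) x = X i.
  exact/(tangentP _ Ac cp).
exists (\sum_(i <- s) a i *: x i); rewrite raddf_sum.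
by apply: eq_bigr => i _; rewrite -xE; exact: linearZ.
Qed.

End Charts.

(** * Lagrangian submanifolds *)

Section LagrangianSubmanifold.
Variables (R : realType) (m k : nat) (M : oriented_submanifold R m).
Hypothesis hkm : (k <= m)%N.
Hypothesis hlag : lagrangian k M.
Implicit Types (c : chart R M m) (p : M) (e : 'I_m -> Cspace R m).
Local Notation F c := (incl_map M \o cparam c).
Local Notation dF c u := ('d (incl_map M \o cparam c) u).

Lemma tangent_dF c p a : atlas M c -> cdom c p -> tangent p (dF c (ccoord c p) a).
Proof. by move=> Ac cp; apply/(tangentP _ Ac cp); exists a. Qed.

Lemma lorentz_basis_frame p e : lorentz_basis k p e -> lorentz_frame_vectors k e.
Proof.
move=> [[te _] ge]; split; first exact: ge.
by move=> j l; have [+ _] := hlag; apply.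
Qed.

Lemma lorentz_basis_exists c p : atlas M c -> cdom c p ->
  exists B : 'M[R]_m, 0 < \det B /\
    lorentz_basis k p (fun l => dF c (ccoord c p) (row l B)).
Proof.
move=> Ac cp; have [omega0 nondeg] := hlag.
have injL := incl_diff_inj Ac (ccoord_img Ac cp).
have [a b|a ma|B [dB BG]] := lorentz_exists hkm injL.
- by apply: omega0; exact: tangent_dF.
- apply: nondeg; first exact: tangent_dF.
  by move=> X' /(tangentP _ Ac cp)[b <-]; exact: ma.
exists B; split=> //; split=> //; split=> [j|X /(tangentP _ Ac cp)[w <-]].
  exact: tangent_dF.
by apply: linear_row_basis => //; rewrite unitmxE unitfE gt_eqF.
Qed.

Lemma positively_oriented_coord c p e : atlas M c -> cdom c p ->
  positively_oriented p e -> exists2 A : 'M[R]_m, 0 < \det A &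
    forall l, e l = dF c (ccoord c p) (row l A).
Proof.
move=> Ac cp [c' [B [[Ac' c'p] dB eB]]].
have [J dJ JE] := chart_change_tangent Ac' Ac c'p cp.
exists (B *m J); first by rewrite det_mulmx mulr_gt0.
move=> l; rewrite row_mul eB; exact: JE.
Qed.

Definition coord_dz c u : R[i] := dz (fun l => dF c u (delta_mx ord0 l)).

Lemma coord_dzE c p e : atlas M c -> cdom c p ->
  lorentz_basis k p e -> positively_oriented p e ->
  exists2 r : R, 0 < r & coord_dz c (ccoord c p) = dz e * real_complex R r.
Proof.
move=> Ac cp le pe; have [A dA eA] := positively_oriented_coord Ac cp pe.
exists (\det A)^-1; first by rewrite invr_gt0.
have -> : e = fun l => dF c (ccoord c p) (row l A) by apply/funext.
rewrite (dz_linear (dF c (ccoord c p))) mulrAC -rmorphM /= divff ?gt_eqF //.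
exact: esym (mul1r _).
Qed.

Lemma dz_phase c p e : atlas M c -> cdom c p ->
  lorentz_basis k p e -> positively_oriented p e ->
  dz e = phase (coord_dz c (ccoord c p)).
Proof.
move=> Ac cp le pe; have [r r0 ->] := coord_dzE Ac cp le pe.
by rewrite phase_pos_mul //; exact: (lorentz_dz_norm (lorentz_basis_frame le)).
Qed.

(** The default 0 of [xget] is not reached, since every chart around [p] carries a positively
    oriented Lorentz basis. *)
Lemma form_TM_value alpha p : exists e,
  [/\ lorentz_basis k p e, positively_oriented p e & form_TM k alpha p = alpha e].
Proof.
have [c Ac cp] := chart_exists p.
have [B [dB lB]] := lorentz_basis_exists Ac cp.
apply: (@xgetPex _ 0 [set z | exists e,
    [/\ lorentz_basis k p e, positively_oriented p e & z = alpha e]]).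
exists (alpha (fun l => dF c (ccoord c p) (row l B))).
exists (fun l => dF c (ccoord c p) (row l B)); split=> //.
by exists c, B.
Qed.

Lemma dz_TM_phase c p : atlas M c -> cdom c p ->
  dz_TM k p = phase (coord_dz c (ccoord c p)).
Proof.
move=> Ac cp; have [e [le pe]] := form_TM_value (@dz R m) p.
by rewrite /dz_TM => ->; exact: dz_phase.
Qed.

Lemma dz_TM_norm p : `|dz_TM k p| = 1.
Proof.
have [e [le pe]] := form_TM_value (@dz R m) p.
by rewrite /dz_TM => ->; exact: (lorentz_dz_norm (lorentz_basis_frame le)).
Qed.

Lemma coord_dz_TM c p : atlas M c -> cdom c p ->
  exists2 r : R, 0 < r & coord_dz c (ccoord c p) = dz_TM k p * real_complex R r.
Proof.
move=> Ac cp; have [e [le pe]] := form_TM_value (@dz R m) p.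
by rewrite /dz_TM => ->; exact: coord_dzE.
Qed.

(** The two sides may select different bases, but [dz] takes on each the phase of the same
    coordinate expression. *)
Lemma dz_theta_TME theta p : dz_theta_TM k theta p = expi theta * dz_TM k p.
Proof.
have [c Ac cp] := chart_exists p.
have [e [le pe]] := form_TM_value (dz_theta theta) p.
by rewrite /dz_theta_TM => ->; rewrite /dz_theta (dz_TM_phase Ac cp) (dz_phase Ac cp le pe).
Qed.

Lemma normal_partP p v :
  normal k p (normal_part k p v) /\ tangent p (v - normal_part k p v).
Proof.
have [c Ac cp] := chart_exists p.
have [B [_]] := lorentz_basis_exists Ac cp.
set e := fun l => _ => -[[te be] ge].
apply: (@xgetPex _ 0 [set N | normal k p N /\ tangent p (v - N)]).
(* The subtracted sum is the tangential part in a Lorentz basis, each [eps] compensating the sign of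
   the squared length of [e j]. *)
exists (v - \sum_j (eps R k j * metric k v (e j)) *: e j).
split=> /=; last by rewrite opprB addrC subrK; exact: tangent_sum.
move=> X /be[a [-> _]]; rewrite metricC metric_suml big1 // => j _.
rewrite metricC metricBl metric_suml (bigD1 j) //= big1 ?addr0 => [|i /negbTE ij].
  by rewrite ge eqxx /eps; case: ifP => _; ring.
by rewrite ge ij mulr0.
Qed.

(** The tangential part of the flat derivative pairs to 0 under [omega]; differentiating
    [omega (Y, dF a) = 0] then moves the derivative from [Y] to [dF a], so only the value of [Y] at
    [p] remains. *)
Lemma second_fundamental_formP c p x x' : atlas M c -> cdom c p ->
  let w := second_fundamental_form k p (dF c (ccoord c p) x) (dF c (ccoord c p) x') in
  normal k p w /\ forall a, omega k w (dF c (ccoord c p) a) =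
    omega k ('d (fun y => dF c y a) (ccoord c p) x) (dF c (ccoord c p) x').
Proof.
move=> Ac cp; set u := ccoord c p.
have cu : cimg c u by exact: ccoord_img.
have [omega0 _] := hlag.
rewrite /=; set w := second_fundamental_form _ _ _ _.
have [Y [tY Yp wE]] : exists Y, [/\ tangent_field_near p Y, Y p = dF c u x' &
    w = normal_part k p (flat_derivative p (dF c u x) Y)].
  apply: (@xgetPex _ 0 [set w | exists Y, [/\ tangent_field_near p Y, Y p = dF c u x' &
    w = normal_part k p (flat_derivative p (dF c u x) Y)]]).
  (* The field with constant coordinates [x'] shows that an extension exists. *)
  pose Y q := dF c (ccoord c q) x'.
  exists (normal_part k p (flat_derivative p (dF c u x) Y)), Y; split=> //.
  exists c; split=> // [r|q cq]; last exact: tangent_dF.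
  have [_ /(_ x') h] := @incl_smooth _ _ _ _ Ac r.+1.
  apply: (Cr_on_eq (cimg_open Ac) _ h) => y cy.
  exact: (congr1 (fun z => dF c z x') (esym (cparamK Ac cy))).
have [dY flatE] := flat_derivativeE x Ac cp tY.
pose D := 'd (Y \o cparam c) u x.
have {}wE : w = normal_part k p D := eq_trans wE (congr1 (normal_part k p) flatE).
have [nw tw] := normal_partP p D; rewrite -wE in nw tw.
split=> // a.
have -> : omega k w (dF c u a) = omega k D (dF c u a).
  have := omega0 _ _ _ tw (tangent_dF a Ac cp).
  by rewrite omegaBl => /eqP; rewrite subr_eq0 => /eqP.
have dW := incl_diff2 a Ac cu.
have Yu : Y (cparam c u) = dF c u x'.
  by rewrite -Yp; congr Y; exact: ccoordK.
have : omega k D (dF c u a) + omega k (Y (cparam c u)) ('d (fun y => dF c y a) u x) = 0.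
  apply: is_derive_near0 (is_derive_omega k x dY dW).
  have [cY [[AcY cYp] _ tangY]] := tY.
  have n1 : nbhs u (cparam c @^-1` cdom cY).
    by apply: cparam_nbhs => //; [exact: cdom_open|rewrite ccoordK].
  have n2 : nbhs u (cimg c) by apply: open_nbhs_nbhs; split=> //; exact: cimg_open.
  apply: filterS (filterI n1 n2) => y [/= cYy cy].
  apply: (omega0 (cparam c y)); first exact: tangY.
  have := tangent_dF a Ac (cparam_dom Ac cy).
  by rewrite (cparamK Ac cy).
by rewrite Yu [X in _ + X]omegaC => /eqP; rewrite subr_eq0 => /eqP.
Qed.

(** The vectors [b] are the chart coordinates of whichever Lorentz basis [xget] selected. *)
Lemma mean_curvatureP c p : atlas M c -> cdom c p ->
  exists b : 'I_m -> 'rV[R]_m, let e j := dF c (ccoord c p) (b j) in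
  [/\ lorentz_basis k p e, normal k p (mean_curvature k p) &
    forall a, omega k (mean_curvature k p) (dF c (ccoord c p) a) =
    \sum_j eps R k j * omega k ('d (fun y => dF c y a) (ccoord c p) (b j)) (e j)].
Proof.
move=> Ac cp; set u := ccoord c p.
have [e [le HE]] : exists e, lorentz_basis k p e /\ mean_curvature k p =
    \sum_(j < m) eps R k j *: second_fundamental_form k p (e j) (e j).
  apply: (@xgetPex _ 0 [set w | exists e, lorentz_basis k p e /\ w =
    \sum_(j < m) eps R k j *: second_fundamental_form k p (e j) (e j)]).
  have [B [_ lB]] := lorentz_basis_exists Ac cp.
  by exists (\sum_(j < m) eps R k j *: second_fundamental_form k p
    (dF c u (row j B)) (dF c u (row j B))), (fun l => dF c u (row l B)).
have /choice[b bE] j : exists x, dF c u x = e j.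
  by apply/(tangentP _ Ac cp); have [[]] := le.
have eE : e = fun j => dF c u (b j) by apply/funext => j; rewrite bE.
exists b; rewrite eE in le HE; split=> //.
  rewrite HE => X tX; rewrite metric_suml big1 // => j _.
  by have [/(_ _ tX) -> _] := second_fundamental_formP (b j) (b j) Ac cp; rewrite mulr0.
move=> a; rewrite HE omega_suml; apply: eq_bigr => j _; congr (_ * _).
by have [_ ->] := second_fundamental_formP (b j) (b j) Ac cp.
Qed.

End LagrangianSubmanifold.

(** * Mean curvature and the phase of dz *)

Section Minimality.
Variables (R : realType) (m k : nat) (M : oriented_submanifold R m).
Hypothesis hkm : (k <= m)%N.
Hypothesis hlag : lagrangian k M.
Implicit Types (c : chart R M m) (p q : M).
Local Notation dF c u := ('d (incl_map M \o cparam c) u).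

Lemma mean_curvature_eq0 c p : atlas M c -> cdom c p ->
  (forall a, omega k (mean_curvature k p) (dF c (ccoord c p) a) = 0) ->
  mean_curvature k p = 0.
Proof.
move=> Ac cp H0; have [b [le nH _]] := mean_curvatureP hkm hlag Ac cp.
apply: (lorentz_orthogonal_eq0 (lorentz_basis_frame hlag le)) => l; last exact: H0.
by apply: nH; exact: tangent_dF.
Qed.

Lemma coord_dz_neq0 c p : atlas M c -> cdom c p -> coord_dz c (ccoord c p) != 0.
Proof.
move=> Ac cp; have [r r0 ->] := coord_dz_TM hkm hlag Ac cp.
rewrite mulf_neq0 //; first by rewrite -normr_eq0 (dz_TM_norm hkm hlag) oner_eq0.
by rewrite eq_complex /= eqxx andbT gt_eqF.
Qed.

(* The imaginary part of the logarithmic derivative of the coordinate expression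
   of [dz] is the Lagrangian angle form, which is dual to [J H]. *)
Lemma coord_dz_derive c p : atlas M c -> cdom c p ->
  exists T : 'rV[R]_m -> R[i],
  (forall a, is_cderive (ccoord c p) a (coord_dz c)
    (coord_dz c (ccoord c p) * T a)) /\
  (forall a, complex.Im (T a) =
    - omega k (mean_curvature k p) (dF c (ccoord c p) a)).
Proof.
move=> Ac cp; have cu := ccoord_img Ac cp.
have [b [le _ oH]] := mean_curvatureP hkm hlag Ac cp.
(* The basis at [p] is extended over the chart with constant coordinates, so its [dz] is a constant
   multiple of [coord_dz]. *)
pose e l y := dF c y (b l).
have lf : lorentz_frame_vectors k (e ^~ (ccoord c p)) := lorentz_basis_frame hlag le.
have de l : differentiable (e l) (ccoord c p) := incl_diff2 (b l) Ac cu.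
pose B : 'M[R]_m := \matrix_l b l.
have eB y : dz (e ^~ y) = real_complex R (\det B) * coord_dz c y.
  rewrite /coord_dz -(dz_linear (dF c y)).
  by congr dz; apply/funext => l; rewrite rowK.
have B0 : \det B != 0.
  apply/eqP => B0; have := lorentz_dz_norm lf; rewrite eB B0 rmorph0 mul0r normr0.
  by move/esym/eqP; rewrite oner_eq0.
have BC0 : real_complex R (\det B) != 0 by rewrite fmorph_eq0.
pose T a := \sum_l real_complex R (eps R k l) *
  herm k ('d (e l) (ccoord c p) a) (e l (ccoord c p)).
exists T; split=> a.
  exact: (is_cderive_unscale BC0 eB (lorentz_dz_derive a de lf)).
have -> : complex.Im (T a) = \sum_l complex.Im (real_complex R (eps R k l) *
    herm k ('d (e l) (ccoord c p) a) (e l (ccoord c p))) by exact: raddf_sum.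
rewrite oH -sumrN; apply: eq_bigr => l _.
rewrite complex_ImM /= mul0r addr0 mulrN; congr (- (_ * omega k _ _)).
(* The directions [a] and [b l] are exchanged here, turning the derivative of the frame into the
   term of the mean curvature formula. *)
exact: incl_schwarz.
Qed.

(** Multiplied by the conjugate of [z], the coordinate expression of [dz] is real on the whole
    chart. The derivative of its imaginary part, a positive multiple of [complex.Im (T a)], is
    therefore 0. *)
Lemma constant_dz_minimal (z : R[i]) : `|z| = 1 -> (forall p : M, dz_TM k p = z) ->
  minimal k M.
Proof.
move=> z1 dzz p; have [c Ac cp] := chart_exists p.
have [T [dT imT]] := coord_dz_derive Ac cp.
have cu := ccoord_img Ac cp.
have zz : conjc z * z = 1 by rewrite mulrC -sqr_normc z1 expr1n.
apply: (mean_curvature_eq0 Ac cp) => a; apply: oppr_inj; rewrite -imT oppr0.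
have [_] := is_cderiveM (is_cderive_cst (ccoord c p) a (conjc z)) (dT a).
have [r r0 dzr] := coord_dz_TM hkm hlag Ac cp.
rewrite mul0r addr0 mulrA dzr dzz mulrA zz mul1r complex_ImM /= mul0r addr0.
move=> /is_derive_near0 h; have : r * complex.Im (T a) = 0.
  apply: h; near=> y.
  have cy : cimg c y by near: y; apply: open_nbhs_nbhs; split=> //; exact: cimg_open.
  have := coord_dz_TM hkm hlag Ac (cparam_dom Ac cy).
  rewrite (cparamK Ac cy) dzz => -[s _ ->].
  by rewrite mulrA zz mul1r.
by move/eqP; rewrite mulf_eq0 gt_eqF //= => /eqP.
Unshelve. all: by end_near. Qed.

(** Minimality makes the logarithmic derivative of [coord_dz] real, so along the segment only its
    modulus can vary. *)
Lemma minimal_phase_segment c (u v : 'rV[R]_m) : minimal k M -> atlas M c ->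
  (forall t : R, 0 <= t <= 1 -> cimg c (u + t *: (v - u))) ->
  phase (coord_dz c v) = phase (coord_dz c u).
Proof.
move=> minM Ac seg.
have dline (t : R) : 0 <= t <= 1 -> exists l : R,
  [/\ is_derive t 1 (fun s : R => complex.Re (coord_dz c (u + s *: (v - u))))
        (l * complex.Re (coord_dz c (u + t *: (v - u)))),
      is_derive t 1 (fun s : R => complex.Im (coord_dz c (u + s *: (v - u))))
        (l * complex.Im (coord_dz c (u + t *: (v - u)))) &
      0 < complex.Re (coord_dz c (u + t *: (v - u))) ^+ 2 +
          complex.Im (coord_dz c (u + t *: (v - u))) ^+ 2].
  move=> /seg; set y := u + t *: _ => cy.
  have cp := cparam_dom Ac cy.
  have [T []] := coord_dz_derive Ac cp; have := coord_dz_neq0 Ac cp.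
  rewrite (cparamK Ac cy) => dz0 /(_ (v - u)) [dre dim] /(_ (v - u)).
  rewrite minM omega0l oppr0 => T0.
  exists (complex.Re (T (v - u))); split.
  - apply: (@is_derive_line _ _ _ (fun y => complex.Re (coord_dz c y))).
    by apply: (is_derive_eq dre); rewrite complex_ReM T0; ring.
  - apply: (@is_derive_line _ _ _ (fun y => complex.Im (coord_dz c y))).
    by apply: (is_derive_eq dim); rewrite complex_ImM T0; ring.
  - rewrite lt_neqAle addr_ge0 ?sqr_ge0 // andbT eq_sym paddr_eq0 ?sqr_ge0 //.
    rewrite !sqrf_eq0; apply: contraNN dz0 => /andP[/eqP re /eqP im].
    by rewrite eq_complex re im !eqxx.
have e1 : u + 1 *: (v - u) = v by rewrite scale1r [u + _]addrC subrK.
have e0 : u + 0 *: (v - u) = u by rewrite scale0r addr0.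
by have := complex_constant_phase dline; rewrite e1 e0.
Qed.

Lemma minimal_near_constant p : minimal k M ->
  \forall q \near p, dz_TM k q = dz_TM k p.
Proof.
move=> minM; have [c Ac cp] := chart_exists p.
have /nbhs_ballP[r /= r0 rc] : nbhs (ccoord c p) (cimg c).
  by apply: open_nbhs_nbhs; split; [exact: cimg_open|exact: ccoord_img].
have ndom : nbhs p (cdom c) by apply: open_nbhs_nbhs; split=> //; exact: cdom_open.
have nball := ccoord_nbhs Ac cp (nbhsx_ballx (ccoord c p) r r0).
apply: filterS (filterI ndom nball) => q [cq bq].
rewrite (dz_TM_phase hkm hlag Ac cq) (dz_TM_phase hkm hlag Ac cp).
(* The segment stays in the ball by convexity. *)
apply: minimal_phase_segment => // t /andP[t0 t1]; apply: rc.
move: bq; rewrite -!ball_normE /=; apply: le_lt_trans.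
rewrite opprD addrA subrr add0r normrN normrZ (ger0_norm t0) distrC.
by rewrite ler_piMl.
Qed.

Lemma minimal_dz_constant : connected [set: M] -> minimal k M ->
  exists z : R[i], `|z| = 1 /\ forall p : M, dz_TM k p = z.
Proof.
move=> conn minM; have [[p0 _]|M0] := pselect (exists p : M, True); last first.
  (* For empty [M] any constant of norm 1 will do. *)
  exists 1; rewrite normr1; split=> // p.
  by case: M0; exists p.
(* Local constancy makes this level set and its complement open, so connectedness forces it to be
   all of [M]. *)
pose B : set M := [set q : M | dz_TM k q = dz_TM k p0].
have BE q : B q = (dz_TM k q = dz_TM k p0) by [].
have oB : open B.
  rewrite openE => q; rewrite BE => Bq.
  apply: filterS (minimal_near_constant q minM) => q' qq'.
  by rewrite BE qq'.
have cB : closed B.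
  rewrite -[B]setCK; apply: open_closedC; rewrite openE => q nBq.
  apply: filterS (minimal_near_constant q minM) => q' qq'.
  by rewrite /setC /= BE qq'.
have BT : B = [set: M].
  apply: conn; first by exists p0.
    by exists B; rewrite ?setTI.
  by exists B; rewrite ?setTI.
exists (dz_TM k p0); split; first exact: dz_TM_norm.
by move=> p; rewrite -BE BT.
Qed.

Lemma expi_exists (z : R[i]) : `|z| = 1 -> exists theta, expi theta * z = 1.
Proof.
case: z => x y; rewrite normc_def => /(congr1 (@complex.Re R)) /= /(congr1 (fun t => t ^+ 2)).
rewrite sqr_sqrtr ?addr_ge0 ?sqr_ge0 // expr1n => xy.
have x1 : -1 <= x <= 1.
  rewrite -ler_norml -[leRHS]normr1 -ler_sqr ?nnegrE // !real_normK ?num_real // expr1n -xy.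
  by rewrite lerDl sqr_ge0.
have cx : cos (acos x) = x by rewrite acosK // in_itv.
have y2 : 1 - x ^+ 2 = y ^+ 2 by rewrite -xy; ring.
have sx : sin (acos x) = `|y| by rewrite sin_acos // y2 sqrtr_sqr.
(* The angle is minus the argument of [z]; [acos x] is that argument up to the sign of [y]. *)
exists (if 0 <= y then - acos x else acos x); rewrite /expi.
case: ifP => y0; rewrite ?cosN ?sinN cx sx.
  by rewrite ger0_norm //; apply: complex_ext => /=; rewrite -?xy; ring.
rewrite ltr0_norm ?ltNge ?y0 //.
by apply: complex_ext => /=; rewrite -?xy; ring.
Qed.

End Minimality.

Theorem proposition2p1 (R : realType) (m k : nat) (hkm : (k <= m)%N)
    (M : oriented_submanifold R m)
    (hconn : connected [set: M])
    (hlag : lagrangian k M) :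
  (minimal k M <->
     exists c : R[i], `|c| = 1 /\ forall p : M, dz_TM k p = c) /\
  ((exists c : R[i], `|c| = 1 /\ forall p : M, dz_TM k p = c) <->
     exists theta : R, forall p : M, dz_theta_TM k theta p = 1).
Proof.
split; split.
- by move=> minM; exact: (minimal_dz_constant hkm hlag hconn minM).
- by move=> [z [z1 dzz]]; exact: (constant_dz_minimal hkm hlag z1 dzz).
- move=> [z [z1 dzz]]; have [theta thetaz] := expi_exists z1.
  by exists theta => p; rewrite (dz_theta_TME hkm hlag) dzz.
move=> [theta dz1]; have [[p0 _]|M0] := pselect (exists p : M, True); last first.
  exists 1; rewrite normr1; split=> // p.
  by case: M0; exists p.
exists (dz_TM k p0); split; first exact: (dz_TM_norm hkm hlag p0).
(* The product of [expi theta] with [dz_TM] is 1 at every point, so cancelling this constant factor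
   shows that [dz_TM] is constant. *)
have expi_neq0 : expi theta != 0.
  have := oner_neq0 R[i]; rewrite -(dz1 p0) (dz_theta_TME hkm hlag).
  by apply: contra_neq => ->; rewrite mul0r.
have expi_dz (p : M) : expi theta * dz_TM k p = 1.
  exact: etrans (esym (dz_theta_TME hkm hlag theta p)) (dz1 p).
by move=> p; exact: mulfI expi_neq0 _ _ (etrans (expi_dz p) (esym (expi_dz p0))).
Qed.
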